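(* Consider, for $\alpha\ge0$ and $q\in[1,\infty)$, the global estimate on real hyperbolic space $\mathbb H^3$ $$\|S^*f\|_{L^q(\mathbb H^3)}\le C\,\|f\|_{H^\alpha(\mathbb H^3)}\qquad\text{for all } f\in\mathscr S^2(\mathbb H^3)_o, \qquad(\ast)$$ with a constant $C$ independent of $f$. Then $(\ast)$ holds for $q=2$ and every $\alpha>1/2$. Moreover, for every $q\in[1,2)$ and every $\alpha>1/2$, the estimate $(\ast)$ fails (i.e. there is no finite constant $C$ for which it holds).
   Context: $\mathbb H^3=SL(2,\mathbb C)/SU(2)$ is real hyperbolic 3-space normalized so that $\rho=1$ (curvature $-1$). A function on $\mathbb H^3$ is radial if it depends only on the geodesic distance $s$ to a fixed base point $o$; write $f(x)=f(s)$. The Riemannian measure is normalized so that $\int f\,dx=\int_0^\infty f(s)\sinh^2 s\,ds$ for radial $f$; $L^q$ norms are with respect to it. The spherical functions are $\varphi_\lambda(s)=\frac{\sin\lambda s}{\lambda\sinh s}$ ($\lambda>0$), the Plancherel density is $|\mathbf c(\lambda)|^{-2}=\lambda^2$, and the spherical Fourier transform of radial $f$ is $\widehat f(\lambda)=\int_0^\infty f(s)\varphi_\lambda(s)\sinh^2 s\,ds$. $\mathscr S^2(\mathbb H^3)_o$ (radial $L^2$-Schwartz class) is the set of smooth radial $f$ with $\sup_{s>0}(1+s)^Ne^{s}|(d/ds)^Mf(s)|<\infty$ for all integers $M,N\ge0$. For such $f$, $\|f\|_{H^\alpha(\mathbb H^3)}=\left(\int_0^\infty(\lambda^2+1)^\alpha|\widehat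 f(\lambda)|^2\lambda^2\,d\lambda\right)^{1/2}$. $S_tf(s)=\int_0^\infty\varphi_\lambda(s)e^{it(\lambda^2+1)}\widehat f(\lambda)\lambda^2\,d\lambda$ and $S^*f(s)=\sup_{0<t<1}|S_tf(s)|$. *)

(* Defs.v *)
From HB Require Import structures.
From mathcomp Require Import all_boot all_order all_algebra.
From mathcomp Require Import all_classical all_reals all_analysis.
From mathcomp Require Export complex.

Set Implicit Arguments.
Unset Strict Implicit.
Unset Printing Implicit Defensive.

Import Order.TTheory GRing.Theory Num.Theory.
Import numFieldNormedType.Exports.
Import ComplexField.Normc.

Local Open Scope classical_set_scope.
Local Open Scope ring_scope.
Local Open Scope complex_scope.

(* A radial function on H^3 is represented by its profile f : R -> R[i], where
   f s is the value at geodesic distance s >= 0 from the base point o; the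
   values of f at negative arguments are irrelevant. *)

Definition sinh {R : realType} (s : R) : R := (expR s - expR (- s)) / 2.

Definition expi {R : realType} (x : R) : R[i] := cos x +i* sin x.

Definition halfline (R : realType) : set R := `]0, +oo[%classic.

(* Lebesgue integral over ]0, +oo[ of a complex function. *)
Definition cintegral {R : realType} (g : R -> R[i]) : R[i] :=
  Rintegral lebesgue_measure (@halfline R) (fun x => complex.Re (g x)) +i*
  Rintegral lebesgue_measure (@halfline R) (fun x => complex.Im (g x)).

(* C^oo: all iterated directional derivatives exist and are continuous. *)
Definition smooth {R : realType} {V : normedModType R} (g : V -> R) : Prop :=
  forall vs : seq V,
    let h : V -> R := foldr (fun v (k : V -> R) => 'D_v k) g vs in
    continuous h /\ (forall x v, derivable h x v).

(* The norm of the normed module 'rV[R]_3 is the sup norm. *)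
Definition euclidean_norm {R : realType} {n : nat} (x : 'rV[R]_n) : R :=
  Num.sqrt (\sum_(i < n) x ord0 i ^+ 2).

(* Smoothness on the manifold H^3 of the radial function with profile f, in
   geodesic normal coordinates at o: the exponential map is a diffeomorphism
   from R^3 onto H^3 and the point with coordinates x is at distance |x|
   from o. *)
Definition smooth_radial {R : realType} (f : R -> R[i]) : Prop :=
  smooth (fun x : 'rV[R]_3 => complex.Re (f (euclidean_norm x))) /\
  smooth (fun x : 'rV[R]_3 => complex.Im (f (euclidean_norm x))).

Definition cderiven {R : realType} (M : nat) (f : R -> R[i]) (s : R) : R[i] :=
  derive1n M (fun r => complex.Re (f r)) s +i*
  derive1n M (fun r => complex.Im (f r)) s.

Definition schwartz2 {R : realType} (f : R -> R[i]) : Prop :=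
  smooth_radial f /\
  forall M N : nat, exists B : R, forall s : R, 0 < s ->
    (1 + s) ^+ N * expR s * normc (cderiven M f s) <= B.

Definition spherical {R : realType} (lambda s : R) : R :=
  sin (lambda * s) / (lambda * sinh s).

Definition spherical_transform {R : realType} (f : R -> R[i]) (lambda : R)
    : R[i] :=
  cintegral (fun s => f s * (spherical lambda s * sinh s ^+ 2)%:C).

Definition sobolev_norm {R : realType} (alpha : R) (f : R -> R[i]) : \bar R :=
  ((\int[lebesgue_measure]_(lambda in @halfline R)
      (((lambda ^+ 2 + 1) `^ alpha)%R
        * normc (spherical_transform f lambda) ^+ 2 * lambda ^+ 2)%R%:E)
   `^ (2^-1))%E.

Definition schrodinger {R : realType} (t : R) (f : R -> R[i]) (s : R) : R[i] :=
  cintegral (fun lambda => (spherical lambda s)%:C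
    * expi (t * (lambda ^+ 2 + 1)) * spherical_transform f lambda
    * (lambda ^+ 2)%:C).

Definition maximal {R : realType} (f : R -> R[i]) (s : R) : \bar R :=
  ereal_sup [set (normc (schrodinger t f s))%:E | t in `]0, 1[%classic].

(* L^q norm on H^3 of a nonnegative radial function with profile g. *)
Definition Lq_norm {R : realType} (q : R) (g : R -> \bar R) : \bar R :=
  ((\int[lebesgue_measure]_(s in @halfline R)
      (g s `^ q * (sinh s ^+ 2)%:E)) `^ q^-1)%E.

Definition maximal_estimate {R : realType} (alpha q : R) : Prop :=
  exists C : R, forall f : R -> R[i], schwartz2 f ->
    (Lq_norm q (maximal f) <= C%:E * sobolev_norm alpha f)%E.

(* Main.v *)
(* Proof idea. With G(l) = l fhat(l), the function sinh(s) S_t f(s) is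
   u(t, s) = int_0^oo sin(l s) e^{i t (l^2 + 1)} G(l) dl, so everything happens
   on the half-line.

   For q = 2 one has to bound int_0^oo sup_t |u(t, s)|^2 ds.  Cutting the
   half-line into unit cells, it suffices to bound sum_k |u(t_k, th + k)|^2
   uniformly in th > 0 and in the times t_k.  By T T^* this is a Schur test for
   the kernel int_0^oo cos(l x) e^{i t l^2} m(l) dl at integer distances, where
   m is comparable with (1 + l^2)^-alpha.  Dominating m by the sum over j of
   4^{-j alpha} e^{-4^-j l^2} reduces it to the Gaussian kernel
   int_0^oo e^{-(r - i t) l^2} cos(l x) dl, whose modulus comes from two
   first-order differential equations, in t and in x.

   For q < 2 the Gaussians f(s) = e^{-e s^2} violate the estimate as e -> 0:
   S_t f tends to a multiple of f as t -> 0, so up to powers of e the left-hand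
   side is at least e^{1/(q^2 e)}, the right-hand side at most e^{1/(4 e)}. *)

Require Import Defs.
From HB Require Import structures.
From mathcomp Require Import all_boot all_order all_algebra.
From mathcomp Require Import all_classical all_reals all_analysis.
From mathcomp Require Import measurable_realfun ring lra zify.

Set Implicit Arguments.
Unset Strict Implicit.
Unset Printing Implicit Defensive.

Import Order.TTheory GRing.Theory Num.Theory.
Import numFieldNormedType.Exports.
Import ComplexField.Normc.

Local Open Scope classical_set_scope.
Local Open Scope ring_scope.
Local Open Scope complex_scope.

(** * Gaussian integrals over the half-line *)

Section halfline_integrals.
Context {R : realType}.
Implicit Types (r t x l : R) (f g : R -> R).

Local Notation mu := (@lebesgue_measure R).
Local Notation D := (@halfline R).
Local Notation Int f := (mu.-integrable D (EFin \o f)).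
Local Notation I f := (Rintegral mu D f).

(** The times [t_k] enter the Schur test only through the differences [t_j - t_k], which stay in
    [[-1, 1]]. On this range the exact modulus of the Gaussian kernel with [r = 4^-j] gives row sums
    O(2^j) at unit separation, however the times are chosen; the series of [4^(-j alpha) 2^j] then
    converges because [alpha > 1/2].

    The maximal function is a supremum over uncountably many times and its measurability is not
    established. Its integrals are therefore handled through the simple functions below it, both for
    the upper bound at [q = 2] and for the lower bound at [q < 2].

    The exponent 2 is critical because of the volume growth [e^(2 s)]: the maximum of
    [2 s - q e s^2] is [1/(q e)], so the L^q norm of the Gaussian is of size [e^(1/(q^2 e))], which
    grows as [q] decreases, while the Sobolev norm is tied to the value [1/4] of [1/q^2] at [q = 2].
    Both sides of the estimate carry the common factor [gauss_cosh_mass e]; once it is cancelled,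
    [e^(d/e)] with [d = 1/q^2 - 1/4 > 0] is compared with a constant. *)

Lemma measurable_halfline : measurable D.
Proof. by rewrite /halfline; exact: measurable_itv. Qed.
Local Notation mD := measurable_halfline.

Lemma derivable_measurable f : (forall l, derivable f l 1) -> measurable_fun D f.
Proof.
move=> df; apply: measurable_funTS; apply: continuous_measurable_fun => l.
by apply: differentiable_continuous; exact/derivable1_diffP.
Qed.

Lemma le_integrable_half f g : measurable_fun D f ->
  (forall l, 0 < l -> `|f l| <= g l) -> Int g -> Int f.
Proof.
move=> mf fg; apply: (@le_integrable _ _ _ mu D mD _ (EFin \o g)).
  exact/measurable_EFinP.
move=> l; rewrite /halfline/= in_itv/= andbT => l0.
by rewrite lee_fin (le_trans (fg _ l0))// ler_norm.
Qed.

Lemma integrable_halfZ c f : Int f -> Int (fun l => c * f l).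
Proof. exact: (@integrableZl _ _ _ mu D mD c (EFin \o f)). Qed.

Lemma integrable_halfD f g : Int f -> Int g -> Int (fun l => f l + g l).
Proof. exact: (@integrableD _ _ _ mu D mD (EFin \o f) (EFin \o g)). Qed.

(** Half of the total mass of the centred normal law of variance [1 / (2 r)], whose density has
    exponent [- r x^2]. *)
Lemma integral_gauss r : 0 < r ->
  (\int[mu]_(l in D) (expR (- (r * l ^+ 2)))%:E)%E = (Num.sqrt (pi / r) / 2)%:E.
Proof.
move=> r0; set s : R := Num.sqrt (r^-1 / 2).
have s2 : s ^+ 2 = r^-1 / 2 by rewrite sqr_sqrtr// divr_ge0 ?invr_ge0 ?ltW.
have s0 : s != 0 by rewrite gt_eqF// sqrtr_gt0 divr_gt0// invr_gt0.
have p0 := normal_peak_gt0 s0.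
have pE : normal_peak s = (Num.sqrt (pi / r))^-1.
  by rewrite /normal_peak s2; congr (Num.sqrt _)^-1; field; rewrite gt_eqF.
have fE : normal_pdf 0 s = fun x => normal_peak s * expR (- (r * x ^+ 2)).
  rewrite normal_pdfE//; apply/funext => x.
  rewrite /normal_fun subr0 s2; congr (_ * expR _).
  by field; rewrite gt_eqF.
have mg : measurable_fun setT (fun x : R => expR (- (r * x ^+ 2))).
  by do 4 apply: measurableT_comp => //.
have := integral_normal_pdf 0 s.
rewrite fE ge0_symfun_integralT; first last.
- by move=> x /=; rewrite sqrrN.
- move=> x; apply: differentiable_continuous; apply/derivable1_diffP.
  exact: ex_derive.
- by move=> x; rewrite mulr_ge0 ?expR_ge0// ltW.
rewrite (_ : [set x | _] = `[0, +oo[%classic); last first.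
  by apply/seteqP; split => x/=; rewrite in_itv/= andbT.
under eq_integral do rewrite EFinM.
rewrite ge0_integralZl_EFin//=; first last.
- by rewrite ltW.
- exact/measurable_EFinP/measurable_funTS.
rewrite -integral_itv_obnd_cbnd; last exact/measurable_EFinP/measurable_funTS.
set J := (\int[_]_(_ in _) _)%E => JE.
have Jfin : J \is a fin_num.
  rewrite fin_numE; apply/andP; split; apply/negP => /eqP JE'; move: JE; rewrite JE'.
    by rewrite !gt0_muleNy ?lte_fin.
  by rewrite !gt0_muley ?lte_fin.
rewrite /halfline -/J; move: JE; rewrite -(fineK Jfin) pE -!EFinM => -[].
move=> JE; congr EFin.
have sp : Num.sqrt (pi / r) != 0 :> R by rewrite gt_eqF// sqrtr_gt0 divr_gt0// pi_gt0.
have solve (a b : R) : b != 0 -> 2 * (b^-1 * a) = 1 -> a = b / 2.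
  by move=> b0 h; rewrite -[RHS]mul1r -[X in X * _]h; field.
exact: solve.
Qed.

Lemma integrable_gauss r : 0 < r -> Int (fun l => expR (- (r * l ^+ 2))).
Proof.
move=> r0; apply/integrableP; split.
  apply/measurable_EFinP; apply: derivable_measurable => l; exact: ex_derive.
under eq_integral do rewrite /= ger0_norm ?expR_ge0//.
by rewrite integral_gauss// ltry.
Qed.

(** Half of the exponent pays for the polynomial factor, by [1 + y <= e^y] at [y = r l^2 / 2]. *)
Lemma gauss2_le r l : 0 < r ->
  (1 + l ^+ 2) * expR (- (r * l ^+ 2)) <= (1 + 2 / r) * expR (- (r / 2 * l ^+ 2)).
Proof.
move=> r0.
have -> : r * l ^+ 2 = r / 2 * l ^+ 2 + r / 2 * l ^+ 2 by field.
rewrite opprD expRD mulrA ler_wpM2r ?expR_ge0//.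
have x0 : 0 <= r / 2 * l ^+ 2 by rewrite mulr_ge0 ?sqr_ge0 ?divr_ge0// ltW.
have := expR_ge1Dx (r / 2 * l ^+ 2); rewrite expRN.
set E := expR _ => hE.
have E0 : 0 < E by exact: expR_gt0.
rewrite ler_pdivrMr// (le_trans _ (ler_wpM2l _ hE)) ?addr_ge0 ?divr_ge0 ?(ltW r0)//.
rewrite -subr_ge0.
have -> : (1 + 2 / r) * (1 + r / 2 * l ^+ 2) - (1 + l ^+ 2) = 2 / r + r / 2 * l ^+ 2.
  by field; rewrite gt_eqF.
by rewrite addr_ge0// divr_ge0// ltW.
Qed.

Lemma integrable_gauss2 r : 0 < r ->
  Int (fun l => (1 + l ^+ 2) * expR (- (r * l ^+ 2))).
Proof.
move=> r0; apply: (@le_integrable_half _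
   (fun l => (1 + 2 / r) * expR (- (r / 2 * l ^+ 2)))).
- by apply: derivable_measurable => l; exact: ex_derive.
- move=> l l0; rewrite ger0_norm ?gauss2_le//.
  by rewrite mulr_ge0 ?expR_ge0// addr_ge0// sqr_ge0.
- by apply: integrable_halfZ; apply: integrable_gauss; rewrite divr_gt0.
Qed.

Lemma Rintegral_gauss r : 0 < r ->
  I (fun l => expR (- (r * l ^+ 2))) = Num.sqrt (pi / r) / 2.
Proof. by move=> r0; rewrite /Rintegral integral_gauss. Qed.

End halfline_integrals.

(** * Integration by parts and differentiation under the integral on the half-line *)

Section halfline_calculus.
Context {R : realType}.
Implicit Types (r t x l : R) (f g : R -> R).

Local Notation mu := (@lebesgue_measure R).
Local Notation D := (@halfline R).
Local Notation Int f := (mu.-integrable D (EFin \o f)).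
Local Notation I f := (Rintegral mu D f).
Local Notation mD := measurable_halfline.

Lemma in_halfline l : D l <-> 0 < l.
Proof. by rewrite /halfline/= in_itv/= andbT. Qed.

Lemma Rintegral_halfZ c f : Int f -> I (fun l => c * f l) = c * I f.
Proof. exact: (@RintegralZl _ _ _ mu D f c mD). Qed.

Lemma Rintegral_halfD f g : Int f -> Int g ->
  I (fun l => f l + g l) = I f + I g.
Proof. exact: (@RintegralD _ _ _ mu D f g mD). Qed.

Lemma integrable_halfN f : Int f -> Int (fun l => - f l).
Proof. exact: (@integrableN _ _ _ mu D (EFin \o f)). Qed.

Lemma integrable_halfB f g : Int f -> Int g -> Int (fun l => f l - g l).
Proof. by move=> h k; apply: integrable_halfD => //; exact: integrable_halfN. Qed.

Lemma Rintegral_halfB f g : Int f -> Int g ->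
  I (fun l => f l - g l) = I f - I g.
Proof. exact: (@RintegralB _ _ _ mu D f g mD). Qed.

Lemma le_Rintegral_half f g : Int f -> Int g ->
  (forall l, 0 < l -> f l <= g l) -> I f <= I g.
Proof.
move=> h k fg; apply: (@le_Rintegral _ _ _ mu D f g mD) => // l /in_halfline.
exact: fg.
Qed.

Lemma eq_Rintegral_half f g : (forall l, 0 < l -> f l = g l) -> I f = I g.
Proof. by move=> fg; apply: eq_Rintegral => l; rewrite inE => /in_halfline/fg. Qed.

Lemma integral_half_EFin f : Int f -> (\int[mu]_(l in D) (f l)%:E)%E = (I f)%:E.
Proof.
by move=> h; rewrite /Rintegral fineK//; exact: (@integrable_fin_num _ _ _ mu D mD _ h).
Qed.

(** The fundamental theorem of calculus on [[0, n+1]], followed by dominated convergence of the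
    truncations of [f]. With [F] a product this is integration by parts. *)
Lemma Rintegral_half_derivative (F f : R -> R) :
  (forall l, is_derive l 1 F (f l)) -> continuous f -> Int f ->
  F n%:R @[n --> \oo] --> 0 -> I f = - F 0.
Proof.
move=> dF cf intf Foo.
have cF : continuous F.
  move=> l; apply: differentiable_continuous; apply/derivable1_diffP.
  exact: (@ex_derive _ _ _ _ _ _ _ (dF l)).
pose fn n l := (f l * \1_(`]0, n.+1%:R[) l)%:E.
have fnE n : (\int[mu]_(l in D) fn n l = (F n.+1%:R)%:E - (F 0)%:E)%E.
  have := @continuous_FTC2 R f F 0 n.+1%:R (ltr0Sn _ _) (continuous_subspaceT cf).
  move=> <-.
  - rewrite integral_itv_bndoo//; last first.
      apply/measurable_EFinP/measurable_funTS; exact: continuous_measurable_fun.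
    have <- : D `&` `]0, n.+1%:R[%classic = `]0, n.+1%:R[%classic.
      by apply: setIidr => l /=; rewrite in_itv/= => /andP[l0 _]; exact/in_halfline.
    rewrite integral_mkcondr; apply: eq_integral => l _.
    by rewrite /fn patchE indicE; case: ifP => _; rewrite ?mulr1 ?mulr0.
  - split.
    + by move=> l _; exact: (@ex_derive _ _ _ _ _ _ _ (dF l)).
    + exact/cvg_at_right_filter/cF.
    + exact/cvg_at_left_filter/cF.
  - by move=> l _; rewrite derive1E; exact: (@derive_val _ _ _ _ _ _ _ (dF l)).
have mfn n : measurable_fun D (fn n).
  apply/measurable_EFinP/measurable_funM; apply/measurable_funTS => //.
  exact: continuous_measurable_fun.
have := @dominated_cvg _ _ _ mu D mD fn (EFin \o f) (EFin \o (fun l => `|f l|)) mfn.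
have h1 : forall l, D l -> fn n l @[n --> \oo] --> (f l)%:E.
  move=> l /in_halfline l0; apply: cvg_near_cst.
  near=> n; rewrite /fn indicE mem_set ?mulr1//= in_itv/= l0/=.
  by apply: (@lt_le_trans _ _ n%:R); [near: n; exact: nbhs_infty_gtr|rewrite ler_nat].
move/(_ h1 (fun _ _ => isT) (integrable_norm intf)).
have h2 n l : D l -> (`|fn n l| <= `|f l|%R%:E)%E.
  move=> _; rewrite /fn lee_fin normrM indicE.
  by case: (_ \in _); rewrite ?normr1 ?mulr1// normr0 mulr0.
move/(_ h2); rewrite integral_half_EFin//; under eq_fun do rewrite fnE -EFinB; move=> /fine_cvg h3.
have h4 : (fun n => F n.+1%:R - F 0) @ \oo --> - F 0.
  rewrite -[X in _ --> X]add0r; apply: cvgB; last exact: cvg_cst.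
  by move: Foo; rewrite -(cvg_shiftS (fun n => F n%:R)).
exact: (cvg_unique _ h3 h4).
Unshelve. all: by end_near. Qed.

Lemma is_derive_Rintegral_half (f df : R -> R -> R) (g : R -> R) :
  (forall p l : R, is_derive p 1 (f^~ l) (df p l)) -> (forall p, Int (f p)) ->
  (forall l, 0 <= g l) -> Int g ->
  (forall p l, 0 < l -> `|df p l| <= g l) ->
  forall p : R, is_derive p 1 (fun p => I (f p)) (I (df p)).
Proof.
move=> dfE intf g0 intg dfg p.
have p1 : (`]p - 1, p + 1[%classic : set R) p.
  by rewrite /= in_itv/= ltrBlDr !ltrDl ltr01.
have dE q l : partial1of2 f q l = df q l.
  by rewrite partial1of2E; exact: (@derive_val _ _ _ _ _ _ _ (dfE q l)).
have h1 q l : (`]p - 1, p + 1[%classic : set R) q -> D l -> derivable (f^~ l) q 1.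
  by move=> _ _; exact: (@ex_derive _ _ _ _ _ _ _ (dfE q l)).
have h2 q l : (`]p - 1, p + 1[%classic : set R) q -> D l -> `|partial1of2 f q l| <= g l.
  by move=> _ /in_halfline l0; rewrite dE; exact: dfg.
apply: DeriveDef.
  exact: (@derivable_under_integral _ _ _ mu f D mD p _ _ p1 (fun q _ => intf q) h1 g g0 intg h2).
rewrite -derive1E (@differentiation_under_integral _ _ _ mu f D mD p _ _ p1 (fun q _ => intf q) h1 g g0 intg h2).
by apply: eq_Rintegral_half => l _; exact: dE.
Qed.

End halfline_calculus.

(** * The modulus of the oscillatory Gaussian kernel *)

Section gauss_kernel.
Context {R : realType}.
Implicit Types (r t x l : R) (p u v : R -> R).

Local Notation mu := (@lebesgue_measure R).
Local Notation D := (@halfline R).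
Local Notation Int f := (mu.-integrable D (EFin \o f)).
Local Notation I f := (Rintegral mu D f).

Definition gauss r l : R := expR (- (r * l ^+ 2)).

(* Real and imaginary parts of the integral of
   [exp (- (r - i t) l^2) cos (l x)] over [l > 0]. *)
Definition gcos r t x : R := I (fun l => gauss r l * (cos (t * l ^+ 2) * cos (l * x))).
Definition gsin r t x : R := I (fun l => gauss r l * (sin (t * l ^+ 2) * cos (l * x))).

Lemma gauss_ge0 r l : 0 <= gauss r l.
Proof. exact: expR_ge0. Qed.

Lemma normr_cos x : `|cos x| <= 1.
Proof. by rewrite ler_norml cos_geN1 cos_le1. Qed.

Lemma normr_sin x : `|sin x| <= 1.
Proof. by rewrite ler_norml sin_geN1 sin_le1. Qed.

Lemma ler_id_1D2 l : 0 < l -> l <= 1 + l ^+ 2.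
Proof. by move=> l0; nra. Qed.

(** The envelope [1 + l^2] covers the prefactors [1], [l] and [l^2] of the kernel and of its
    derivatives in [x] and [t], so that one dominating function serves throughout. *)
Lemma gauss_trig_le r l (p u v : R) : `|p| <= 1 + l ^+ 2 -> `|u| <= 1 -> `|v| <= 1 ->
  `|p * (gauss r l * (u * v))| <= (1 + l ^+ 2) * gauss r l.
Proof.
move=> hp hu hv; rewrite !normrM (ger0_norm (gauss_ge0 r l)).
rewrite ler_pM ?mulr_ge0 ?gauss_ge0//.
by rewrite ler_piMr ?gauss_ge0// mulr_ile1.
Qed.

Lemma integrable_gauss_trig r p u v : 0 < r ->
  (forall l, 0 < l -> `|p l| <= 1 + l ^+ 2) ->
  (forall l, `|u l| <= 1) -> (forall l, `|v l| <= 1) ->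
  (forall l, derivable p l 1) -> (forall l, derivable u l 1) ->
  (forall l, derivable v l 1) -> Int (fun l => p l * (gauss r l * (u l * v l))).
Proof.
move=> r0 hp hu hv dp du dv.
apply: (@le_integrable_half _ _ (fun l => (1 + l ^+ 2) * gauss r l)).
- apply: derivable_measurable => l.
  apply: derivableM; first exact: dp.
  by apply: derivableM; [exact: ex_derive|apply: derivableM; [exact: du|exact: dv]].
- by move=> l l0; apply: gauss_trig_le => //; exact: hp.
- exact: integrable_gauss2.
Qed.

Lemma gauss_trig_cvg0 r p u v : 0 < r ->
  (forall l, 0 < l -> `|p l| <= 1 + l ^+ 2) ->
  (forall l, `|u l| <= 1) -> (forall l, `|v l| <= 1) ->
  p n%:R * (gauss r n%:R * (u n%:R * v n%:R)) @[n --> \oo] --> 0.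
Proof.
(* The shift by one avoids [l = 0], where nothing is assumed about [p]. *)
move=> r0 hp hu hv; rewrite -cvg_shiftS; apply/norm_cvg0P.
pose c := (1 + 2 / r) * (2 / r).
apply: (@squeeze_cvgr _ _ _ _ (cst 0) (fun n => c * harmonic n)).
- near=> n; rewrite normr_ge0/=.
  have n0 : 0 < n.+1%:R :> R by rewrite ltr0n.
  apply: (le_trans (gauss_trig_le _ (hp _ n0) (hu _) (hv _))).
  apply: (le_trans (gauss2_le _ r0)).
  have -> : c * harmonic n = (1 + 2 / r) * (r / 2 * n.+1%:R)^-1.
    by rewrite /c /harmonic/= -mulrA invfM invf_div.
  rewrite ler_wpM2l ?addr_ge0 ?divr_ge0 ?(ltW r0)// expRN.
  have rn0 : 0 < r / 2 * n.+1%:R by rewrite mulr_gt0 ?divr_gt0.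
  rewrite lef_pV2 ?posrE ?expR_gt0//.
  apply: (le_trans _ (expR_ge1Dx _)).
  apply: (@le_trans _ _ (r / 2 * n.+1%:R ^+ 2)); last by rewrite lerDr.
  by rewrite ler_wpM2l ?divr_ge0 ?(ltW r0)// expr2 ler_peMr ?ler1n// ltW.
- exact: cvg_cst.
- by rewrite -[X in _ --> X](mulr0 c); apply: cvgMr; exact: cvg_harmonic.
Unshelve. all: by end_near. Qed.

Lemma normr_id_1D2 l : 0 < l -> `|l| <= 1 + l ^+ 2.
Proof. by move=> l0; rewrite ger0_norm ?ler_id_1D2// ltW. Qed.

Lemma normr_sqr_1D2 l : 0 < l -> `|l ^+ 2| <= 1 + l ^+ 2.
Proof. by move=> l0; rewrite ger0_norm ?sqr_ge0// lerDr. Qed.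

Lemma normr1_1D2 l : 0 < l -> `|1 : R| <= 1 + l ^+ 2.
Proof. by move=> l0; rewrite normr1 lerDl sqr_ge0. Qed.

Lemma integrable_gauss_trig1 r u v : 0 < r ->
  (forall l, `|u l| <= 1) -> (forall l, `|v l| <= 1) ->
  (forall l, derivable u l 1) -> (forall l, derivable v l 1) ->
  Int (fun l => gauss r l * (u l * v l)).
Proof.
move=> r0 hu hv du dv.
rewrite (_ : (fun l => _) = (fun l => 1 * (gauss r l * (u l * v l)))).
  apply: (@integrable_gauss_trig r (fun=> 1) u v r0 normr1_1D2 hu hv _ du dv).
  by move=> l; exact: derivable_cst.
by apply/funext => l; rewrite mul1r.
Qed.

Section fixed_r.
Variable r : R.
Hypothesis r0 : 0 < r.

(** The letter records the trigonometric factor in [t], the digit the power of [l]. Degree 1 comes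
    from differentiation in [x], which turns [cos (l x)] into [sin (l x)]; degree 2 comes from
    differentiation in [t]. *)
Let c0 t x l := gauss r l * (cos (t * l ^+ 2) * cos (l * x)).
Let s0 t x l := gauss r l * (sin (t * l ^+ 2) * cos (l * x)).
Let c1 t x l := l * (gauss r l * (cos (t * l ^+ 2) * sin (l * x))).
Let s1 t x l := l * (gauss r l * (sin (t * l ^+ 2) * sin (l * x))).
Let c2 t x l := l ^+ 2 * (gauss r l * (cos (t * l ^+ 2) * cos (l * x))).
Let s2 t x l := l ^+ 2 * (gauss r l * (sin (t * l ^+ 2) * cos (l * x))).


Lemma integrable_c0 t x : Int (c0 t x).
Proof.
apply: integrable_gauss_trig1 => [|l|l|l|l]; [exact: r0|exact: normr_cos|exact: normr_cos| |];
  exact: ex_derive.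
Qed.
Lemma integrable_s0 t x : Int (s0 t x).
Proof.
apply: integrable_gauss_trig1 => [|l|l|l|l]; [exact: r0|exact: normr_sin|exact: normr_cos| |];
  exact: ex_derive.
Qed.
Lemma integrable_c1 t x : Int (c1 t x).
Proof.
apply: (@integrable_gauss_trig r id) => [|l|l|l|l|l|l];
  [exact: r0|exact: normr_id_1D2|exact: normr_cos|exact: normr_sin| | |];
  exact: ex_derive.
Qed.
Lemma integrable_s1 t x : Int (s1 t x).
Proof.
apply: (@integrable_gauss_trig r id) => [|l|l|l|l|l|l];
  [exact: r0|exact: normr_id_1D2|exact: normr_sin|exact: normr_sin| | |];
  exact: ex_derive.
Qed.
Lemma integrable_c2 t x : Int (c2 t x).
Proof.
apply: (@integrable_gauss_trig r (fun l => l ^+ 2)) => [|l|l|l|l|l|l];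
  [exact: r0|exact: normr_sqr_1D2|exact: normr_cos|exact: normr_cos| | |];
  exact: ex_derive.
Qed.
Lemma integrable_s2 t x : Int (s2 t x).
Proof.
apply: (@integrable_gauss_trig r (fun l => l ^+ 2)) => [|l|l|l|l|l|l];
  [exact: r0|exact: normr_sqr_1D2|exact: normr_sin|exact: normr_cos| | |];
  exact: ex_derive.
Qed.

Let lin3 a b c f g h : Int f -> Int g -> Int h ->
  Int (fun l => a * f l + b * g l + c * h l) /\
  I (fun l => a * f l + b * g l + c * h l) = a * I f + b * I g + c * I h.
Proof.
move=> hf hg hh; split.
  by do 2?apply: integrable_halfD; apply: integrable_halfZ.
rewrite Rintegral_halfD ?Rintegral_halfD ?Rintegral_halfZ//;
  by do ?apply: integrable_halfD; apply: integrable_halfZ.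
Qed.

Let parts (F f : R -> R) : (forall l : R, is_derive l 1 F (f l)) ->
  (forall l, derivable f l 1) -> Int f -> F n%:R @[n --> \oo] --> 0 -> F 0 = 0 ->
  I f = 0.
Proof.
move=> dF df intf Foo F0; rewrite (Rintegral_half_derivative dF _ intf Foo).
  by rewrite F0 oppr0.
by move=> l; apply: differentiable_continuous; exact/derivable1_diffP.
Qed.

(** Together with [parts_sin_x] this expresses the first moments [c1] and [s1] through the kernel
    itself, which closes the differential equation in [x]. *)
Lemma parts_cos_x t x :
  - (2 * r) * I (c1 t x) + - (2 * t) * I (s1 t x) + x * I (c0 t x) = 0.
Proof.
have [intf <-] := lin3 (- (2 * r)) (- (2 * t)) (x) (integrable_c1 t x) (integrable_s1 t x) (integrable_c0 t x).
apply: (@parts (fun l => 1 * (gauss r l * (cos (t * l ^+ 2) * sin (l * x))))) => [l|l|||].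
- rewrite /gauss; apply: is_derive_eq.
  by rewrite /c0 /s0 /c1 /s1 /c2 /s2 /gauss /GRing.scale/=; ring.
- by rewrite /c0 /s0 /c1 /s1 /c2 /s2 /gauss; exact: ex_derive.
- exact: intf.
- apply: (@gauss_trig_cvg0 r (fun=> 1) (fun l => cos (t * l ^+ 2)) (fun l => sin (l * x))) => [|l|l|l];
    [exact: r0|exact: normr1_1D2|exact: normr_cos|exact: normr_sin].
- by rewrite mul0r sin0 !mulr0.
Qed.

Lemma parts_sin_x t x :
  - (2 * r) * I (s1 t x) + (2 * t) * I (c1 t x) + x * I (s0 t x) = 0.
Proof.
have [intf <-] := lin3 (- (2 * r)) ((2 * t)) (x) (integrable_s1 t x) (integrable_c1 t x) (integrable_s0 t x).
apply: (@parts (fun l => 1 * (gauss r l * (sin (t * l ^+ 2) * sin (l * x))))) => [l|l|||].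
- rewrite /gauss; apply: is_derive_eq.
  by rewrite /c0 /s0 /c1 /s1 /c2 /s2 /gauss /GRing.scale/=; ring.
- by rewrite /c0 /s0 /c1 /s1 /c2 /s2 /gauss; exact: ex_derive.
- exact: intf.
- apply: (@gauss_trig_cvg0 r (fun=> 1) (fun l => sin (t * l ^+ 2)) (fun l => sin (l * x))) => [|l|l|l];
    [exact: r0|exact: normr1_1D2|exact: normr_sin|exact: normr_sin].
- by rewrite mul0r sin0 !mulr0.
Qed.

(** The extra factor [l] in the boundary function produces the second moments. At [x = 0] the
    derivative of [cos (l x)] contributes nothing, so the relations close on [c0] and [s0] and give
    the equation in [t]. *)
Lemma parts_cos_0 t :
  - (2 * r) * I (c2 t 0) + - (2 * t) * I (s2 t 0) + 1 * I (c0 t 0) = 0.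
Proof.
have [intf <-] := lin3 (- (2 * r)) (- (2 * t)) (1) (integrable_c2 t 0) (integrable_s2 t 0) (integrable_c0 t 0).
apply: (@parts (fun l => l * (gauss r l * (cos (t * l ^+ 2) * cos (l * 0))))) => [l|l|||].
- rewrite /gauss; apply: is_derive_eq.
  by rewrite /c0 /s0 /c1 /s1 /c2 /s2 /gauss /GRing.scale/=; ring.
- by rewrite /c0 /s0 /c1 /s1 /c2 /s2 /gauss; exact: ex_derive.
- exact: intf.
- apply: (@gauss_trig_cvg0 r (id) (fun l => cos (t * l ^+ 2)) (fun l => cos (l * 0))) => [|l|l|l];
    [exact: r0|exact: normr_id_1D2|exact: normr_cos|exact: normr_cos].
- by rewrite mul0r.
Qed.

Lemma parts_sin_0 t :
  - (2 * r) * I (s2 t 0) + (2 * t) * I (c2 t 0) + 1 * I (s0 t 0) = 0.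
Proof.
have [intf <-] := lin3 (- (2 * r)) ((2 * t)) (1) (integrable_s2 t 0) (integrable_c2 t 0) (integrable_s0 t 0).
apply: (@parts (fun l => l * (gauss r l * (sin (t * l ^+ 2) * cos (l * 0))))) => [l|l|||].
- rewrite /gauss; apply: is_derive_eq.
  by rewrite /c0 /s0 /c1 /s1 /c2 /s2 /gauss /GRing.scale/=; ring.
- by rewrite /c0 /s0 /c1 /s1 /c2 /s2 /gauss; exact: ex_derive.
- exact: intf.
- apply: (@gauss_trig_cvg0 r (id) (fun l => sin (t * l ^+ 2)) (fun l => cos (l * 0))) => [|l|l|l];
    [exact: r0|exact: normr_id_1D2|exact: normr_sin|exact: normr_cos].
- by rewrite mul0r.
Qed.

Let G l := (1 + l ^+ 2) * gauss r l.

Let G0 l : 0 <= G l.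
Proof. by rewrite mulr_ge0 ?gauss_ge0// addr_ge0// sqr_ge0. Qed.

Lemma is_derive_gcos_x t x : is_derive x 1 (gcos r t) (- I (c1 t x)).
Proof.
have -> : - I (c1 t x) = I (fun l => -1 * c1 t x l).
  by rewrite Rintegral_halfZ ?mulN1r//; exact: integrable_c1.
apply: (@is_derive_Rintegral_half _ (c0 t) (fun x l => -1 * c1 t x l) G).
- by move=> p l; rewrite /c0 /c1; apply: is_derive_eq; rewrite /GRing.scale/=; ring.
- exact: integrable_c0.
- exact: G0.
- exact: integrable_gauss2.
- move=> p l l0; rewrite mulN1r normrN.
  by apply: gauss_trig_le; [exact: normr_id_1D2|exact: normr_cos|exact: normr_sin].
Qed.

Lemma is_derive_gsin_x t x : is_derive x 1 (gsin r t) (- I (s1 t x)).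
Proof.
have -> : - I (s1 t x) = I (fun l => -1 * s1 t x l).
  by rewrite Rintegral_halfZ ?mulN1r//; exact: integrable_s1.
apply: (@is_derive_Rintegral_half _ (s0 t) (fun x l => -1 * s1 t x l) G).
- by move=> p l; rewrite /s0 /s1; apply: is_derive_eq; rewrite /GRing.scale/=; ring.
- exact: integrable_s0.
- exact: G0.
- exact: integrable_gauss2.
- move=> p l l0; rewrite mulN1r normrN.
  by apply: gauss_trig_le; [exact: normr_id_1D2|exact: normr_sin|exact: normr_sin].
Qed.

Lemma is_derive_gcos_t t x : is_derive t 1 (fun t => gcos r t x) (- I (s2 t x)).
Proof.
have -> : - I (s2 t x) = I (fun l => -1 * s2 t x l).
  by rewrite Rintegral_halfZ ?mulN1r//; exact: integrable_s2.
apply: (@is_derive_Rintegral_half _ (fun t => c0 t x) (fun t l => -1 * s2 t x l) G).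
- by move=> p l; rewrite /c0 /s2; apply: is_derive_eq; rewrite /GRing.scale/=; ring.
- by move=> p; exact: integrable_c0.
- exact: G0.
- exact: integrable_gauss2.
- move=> p l l0; rewrite mulN1r normrN.
  by apply: gauss_trig_le; [exact: normr_sqr_1D2|exact: normr_sin|exact: normr_cos].
Qed.

Lemma is_derive_gsin_t t x : is_derive t 1 (fun t => gsin r t x) (I (c2 t x)).
Proof.
apply: (@is_derive_Rintegral_half _ (fun t => s0 t x) (fun t => c2 t x) G).
- by move=> p l; rewrite /s0 /c2; apply: is_derive_eq; rewrite /GRing.scale/=; ring.
- by move=> p; exact: integrable_s0.
- exact: G0.
- exact: integrable_gauss2.
- move=> p l l0.
  by apply: gauss_trig_le; [exact: normr_sqr_1D2|exact: normr_cos|exact: normr_cos].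
Qed.

Let E t x := gcos r t x ^+ 2 + gsin r t x ^+ 2.

Let a0 t : 0 < r ^+ 2 + t ^+ 2.
Proof. by rewrite ltr_pwDl ?exprn_gt0// sqr_ge0. Qed.

(* [E] solves [dE/dx = - (x r / (r^2 + t^2)) E]. *)
Let E_x t x : E t x * expR (x ^+ 2 * r / (2 * (r ^+ 2 + t ^+ 2))) = E t 0.
Proof.
pose f y := E t y * expR (y ^+ 2 * r / (2 * (r ^+ 2 + t ^+ 2))).
have -> : E t 0 = f 0 by rewrite /f expr0n/= !mul0r expR0 mulr1.
apply: (@is_derive_0_is_cst _ f) => y.
have dc := is_derive_gcos_x t y; have ds := is_derive_gsin_x t y.
rewrite /f /E; apply: is_derive_eq.
have := parts_cos_x t y; have := parts_sin_x t y.
rewrite -/(gcos r t y) -/(gsin r t y) /GRing.scale/=.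
move: (expR _) (gcos r t y) (gsin r t y) (I (c1 t y)) (I (s1 t y)) (a0 t) => e A B C S a00 h1 h2.
have a1 : 2 * (r ^+ 2 + t ^+ 2) != 0 by rewrite mulf_neq0// gt_eqF.
(* A linear system for [C] and [S] with determinant [4 (r^2 + t^2)]; it is solved explicitly so that
   the derivative becomes a rational identity. *)
have hA : y * A = 2 * r * C + 2 * t * S by lra.
have hB : y * B = 2 * r * S - 2 * t * C by lra.
have hC : C = (r * (y * A) - t * (y * B)) / (2 * (r ^+ 2 + t ^+ 2)).
  by apply: (mulIf a1); rewrite divfK// hA hB; ring.
have hS : S = (r * (y * B) + t * (y * A)) / (2 * (r ^+ 2 + t ^+ 2)).
  by apply: (mulIf a1); rewrite divfK// hA hB; ring.
clear hA hB.
by rewrite hC hS; field; rewrite gt_eqF.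
Qed.

(* At [x = 0], [dE/dt = - (t / (r^2 + t^2)) E]. *)
Let E_t t : E t 0 ^+ 2 * (r ^+ 2 + t ^+ 2) = E 0 0 ^+ 2 * r ^+ 2.
Proof.
pose f y := E y 0 ^+ 2 * (r ^+ 2 + y ^+ 2).
have -> : E 0 0 ^+ 2 * r ^+ 2 = f 0 by rewrite /f expr0n/= addr0.
apply: (@is_derive_0_is_cst _ f) => y.
have dc := is_derive_gcos_t y 0; have ds := is_derive_gsin_t y 0.
rewrite /f /E; apply: is_derive_eq.
have := parts_cos_0 y; have := parts_sin_0 y.
rewrite -/(gcos r y 0) -/(gsin r y 0) /GRing.scale/=.
move: (gcos r y 0) (gsin r y 0) (I (c2 y 0)) (I (s2 y 0)) (a0 y) => A B C S a00 h1 h2.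
have a1 : 2 * (r ^+ 2 + y ^+ 2) != 0 by rewrite mulf_neq0// gt_eqF.
have hA : A = 2 * r * C + 2 * y * S by lra.
have hB : B = 2 * r * S - 2 * y * C by lra.
have hC : C = (r * A - y * B) / (2 * (r ^+ 2 + y ^+ 2)).
  by apply: (mulIf a1); rewrite divfK// hA hB; ring.
have hS : S = (r * B + y * A) / (2 * (r ^+ 2 + y ^+ 2)).
  by apply: (mulIf a1); rewrite divfK// hA hB; ring.
clear hA hB.
by rewrite hC hS; field; rewrite gt_eqF.
Qed.

Lemma gcos00 : gcos r 0 0 = Num.sqrt (pi / r) / 2.
Proof.
rewrite -Rintegral_gauss//; apply: eq_Rintegral_half => l _.
by rewrite mul0r mulr0 cos0 !mulr1.
Qed.

Lemma gsin0x x : gsin r 0 x = 0.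
Proof.
rewrite /gsin (@eq_Rintegral_half _ _ (fun=> 0)) ?Rintegral_cst ?mul0r//.
  exact: measurable_halfline.
by move=> l _; rewrite mul0r sin0 mul0r mulr0.
Qed.

(** The kernel is [sqrt (pi / (r - i t)) / 2] times [exp (- x^2 / (4 (r - i t)))]. Its squared
    modulus still contains the square root of [r^2 + t^2]; squaring once more removes it. *)
Lemma gauss_kernelE t x :
  (gcos r t x ^+ 2 + gsin r t x ^+ 2) ^+ 2 * (r ^+ 2 + t ^+ 2)
    * expR (x ^+ 2 * r / (r ^+ 2 + t ^+ 2)) = pi ^+ 2 / 16.
Proof.
have a1 : r ^+ 2 + t ^+ 2 != 0 by rewrite gt_eqF.
have -> : expR (x ^+ 2 * r / (r ^+ 2 + t ^+ 2)) =
    expR (x ^+ 2 * r / (2 * (r ^+ 2 + t ^+ 2))) ^+ 2.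
  by rewrite -expRM_natl; congr expR; field.
rewrite mulrAC -exprMn -/(E t x) E_x E_t /E gcos00 gsin0x.
have -> : (Num.sqrt (pi / r) / 2) ^+ 2 = pi / (4 * r) :> R.
  rewrite expr_div_n sqr_sqrtr ?divr_ge0 ?pi_ge0 ?(ltW r0)//.
  by field; rewrite gt_eqF.
by rewrite [0 ^+ 2]expr0n/= addr0; field; rewrite gt_eqF.
Qed.

(** At [t = 0] the equation in [x] is scalar and gives the kernel with its sign, not only its
    modulus; the inversion formula for the Gaussian data rests on this. *)
Lemma gcos_0 x : gcos r 0 x = Num.sqrt (pi / r) / 2 * expR (- (x ^+ 2 / (4 * r))).
Proof.
pose f y := gcos r 0 y * expR (y ^+ 2 / (4 * r)).
suff : f x = f 0.
  rewrite /f expr0n/= mul0r expR0 mulr1 gcos00 => <-.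
  by rewrite expRN mulfK// gt_eqF// expR_gt0.
apply: (@is_derive_0_is_cst _ f) => y.
have dc := is_derive_gcos_x 0 y.
rewrite /f; apply: is_derive_eq.
have := parts_cos_x 0 y.
rewrite -/(gcos r 0 y) /GRing.scale/=.
move: (expR _) (gcos r 0 y) (I (c1 0 y)) (I (s1 0 y)) => e A C S h1.
have r1 : r != 0 by rewrite gt_eqF.
have hC : C = y * A / (2 * r).
  by apply: (@mulIf _ (2 * r)); rewrite ?mulf_neq0// divfK ?mulf_neq0//; lra.
by rewrite hC; field.
Qed.

End fixed_r.
End gauss_kernel.

(** * A majorant of the kernel at integer distances and its row sums *)

Section kernel_majorant.
Context {R : realType}.
Implicit Types (r t x z : R) (L d n : nat).

(* Bounds the kernel with [r = L^-2] at distance [d], uniformly in [|t| <= 1];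
   its sum over [d] is [O(L)], which is what the condition [alpha > 1/2] needs. *)
Definition majorant L d : R :=
  if d == 0 then L%:R
  else if (d <= L)%N then Num.sqrt (L%:R / d%:R) else 7 * (L%:R / d%:R) ^+ 2.

Lemma majorant_ge0 L d : 0 <= majorant L d.
Proof.
by rewrite /majorant; case: eqP => // _; case: leqP => _; rewrite ?sqrtr_ge0// mulr_ge0 ?sqr_ge0.
Qed.

Lemma ler_expr4 (a b : R) : 0 <= b -> a ^+ 4 <= b ^+ 4 -> `|a| <= b.
Proof.
move=> b0 h; rewrite leNgt; apply/negP => ba; move: h; rewrite leNgt => /negP; apply.
by rewrite -[a ^+ 4]ger0_norm ?exprn_even_ge0// normrX ltrXn2r// ger0_norm.
Qed.

Lemma pi_le4 : pi <= 4 :> R.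
Proof. by have /andP[_] := @pihalf_02 R; lra. Qed.

(** With [a = r^2 + t^2], which lies between [r^2] and 2, and [y = x^2 r / a], the closed form and
    [pi <= 4] give [z^4 a e^y <= 1]. The three branches of the majorant come from [e^y >= 1],
    [e^y >= y] and [e^y >= (y / 4)^4]; in the last one [256 a^3 <= 2048 <= 7^4], whence the constant
    7. *)
Lemma gauss_kernel_le L d t x z : (0 < L)%N -> `|t| <= 1 -> d%:R <= `|x| ->
  (z = gcos (L%:R ^- 2) t x \/ z = gsin (L%:R ^- 2) t x) -> `|z| <= majorant L d.
Proof.
move=> L0 t1 dx hz.
have Lr : 1 <= L%:R :> R by rewrite ler1n.
set r : R := L%:R ^- 2.
have r0 : 0 < r by rewrite invr_gt0 exprn_gt0// ltr0n.
have r1 : r <= 1 by rewrite invf_le1 ?exprn_gt0 ?ltr0n// exprn_ege1.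
have t2 : t ^+ 2 <= 1 by rewrite -[t ^+ 2]ger0_norm ?sqr_ge0// normrX exprn_ile1.
set a := r ^+ 2 + t ^+ 2.
have a0 : 0 < a by rewrite ltr_pwDl ?exprn_gt0// sqr_ge0.
have a2 : a <= 2 by rewrite /a; nra.
have ra : r ^+ 2 <= a by rewrite lerDl sqr_ge0.
have z4 : z ^+ 4 * a * expR (x ^+ 2 * r / a) <= 1.
  apply: (@le_trans _ _ (pi ^+ 2 / 16)).
    rewrite -(gauss_kernelE r0 t x) ler_wpM2r ?expR_ge0// ler_wpM2r ?(ltW a0)//.
    rewrite (_ : 4 = 2 * 2)%N// exprM ler_sqr ?nnegrE ?addr_ge0 ?sqr_ge0//.
    by case: hz => ->; rewrite ?lerDl ?lerDr sqr_ge0.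
  rewrite ler_pdivrMr// mul1r (_ : 16 = 4 ^+ 2)//; last by rewrite -natrX.
  by rewrite ler_sqr ?nnegrE ?pi_ge0 ?pi_le4.
have d2 : d%:R ^+ 2 <= x ^+ 2 by rewrite -[x ^+ 2]ger0_norm ?sqr_ge0// normrX ler_sqr ?nnegrE.
have Lrr : L%:R ^+ 2 * r = 1 by rewrite mulfV// expf_neq0// pnatr_eq0 -lt0n.
have z40 : 0 <= z ^+ 4 by rewrite exprn_even_ge0.
have y0 : 0 <= x ^+ 2 * r / a by apply: divr_ge0; [apply: mulr_ge0; [exact: sqr_ge0|exact: ltW]|exact: ltW].
rewrite /majorant; case: eqP => [_|/eqP d0].
  apply: ler_expr4 => //.
  have : z ^+ 4 * r ^+ 2 <= 1.
    apply: le_trans z4; apply: (@le_trans _ _ (z ^+ 4 * a)); first by rewrite ler_wpM2l.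
    rewrite ler_peMr; [by []|by rewrite mulr_ge0 ?(ltW a0)|by rewrite -expR0 ler_expR].
  rewrite (_ : L%:R ^+ 4 = (r ^+ 2)^-1); last by rewrite /r exprVn invrK -exprM.
  by rewrite -ler_pdivlMr ?exprn_gt0// div1r.
have dr : 0 < d%:R :> R by rewrite ltr0n lt0n.
case: leqP => _; apply: ler_expr4; rewrite ?sqrtr_ge0 ?mulr_ge0 ?sqr_ge0//.
  rewrite (_ : 4 = 2 * 2)%N// [X in _ <= X]exprM sqr_sqrtr ?divr_ge0//.
  rewrite expr_div_n ler_pdivlMr ?exprn_gt0//.
  have : z ^+ 4 * a * (x ^+ 2 * r / a) <= 1.
    apply: le_trans z4; rewrite ler_wpM2l ?(mulr_ge0 z40 (ltW a0))//.
    by apply: le_trans (expR_ge1Dx _); rewrite lerDr.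
  rewrite (_ : _ * _ = z ^+ 4 * x ^+ 2 * r); last by field; rewrite gt_eqF.
  move=> h; apply: (@le_trans _ _ (z ^+ 4 * x ^+ 2)); first by rewrite ler_wpM2l.
  apply: (@le_trans _ _ (L%:R ^+ 2 * (z ^+ 4 * x ^+ 2 * r))).
    by rewrite [X in _ <= X]mulrCA Lrr [X in _ <= X]mulr1.
  by rewrite ler_piMr ?sqr_ge0.
have : z ^+ 4 * a * (x ^+ 2 * r / a / 4) ^+ 4 <= 1.
  apply: le_trans z4; rewrite ler_wpM2l ?(mulr_ge0 z40 (ltW a0))//.
  rewrite {2}(_ : x ^+ 2 * r / a = 4%:R * (x ^+ 2 * r / a / 4)); last by field; rewrite gt_eqF.
  rewrite expRM_natl lerXn2r ?nnegrE ?expR_ge0 ?(divr_ge0 y0)//.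
  by apply: le_trans (expR_ge1Dx _); rewrite lerDr.
move=> h.
have h2 : z ^+ 4 * d%:R ^+ 8 * r ^+ 4 <= 2048.
  apply: (@le_trans _ _ (z ^+ 4 * x ^+ 8 * r ^+ 4)).
    rewrite ler_wpM2r ?exprn_ge0 ?(ltW r0)// ler_wpM2l//.
    by rewrite (_ : 8 = 2 * 4)%N// !exprM lerXn2r ?nnegrE ?sqr_ge0.
  rewrite (_ : _ * _ = 256 * a ^+ 3 * (z ^+ 4 * a * (x ^+ 2 * r / a / 4) ^+ 4)); last first.
    by field; rewrite gt_eqF.
  apply: (@le_trans _ _ (256 * a ^+ 3 * 1)).
    by rewrite ler_wpM2l ?mulr_ge0 ?exprn_ge0 ?(ltW a0).
  have : a ^+ 3 <= 2 ^+ 3 by rewrite lerXn2r ?nnegrE ?(ltW a0).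
  by move=> ?; lra.
rewrite exprMn -exprM expr_div_n mulrA ler_pdivlMr ?exprn_gt0//.
have -> : z ^+ 4 * d%:R ^+ 8 = z ^+ 4 * d%:R ^+ 8 * r ^+ 4 * (L%:R ^+ 2) ^+ 4.
  by rewrite -mulrA -exprMn (mulrC r) Lrr expr1n mulr1.
rewrite -exprM ler_wpM2r ?exprn_ge0//.
by apply: (le_trans h2); rewrite -natrX ler_nat.
Qed.

Lemma sum_majorant_le L n : (0 < L)%N -> \sum_(d < n) majorant L d <= 10 * L%:R.
Proof.
move=> L0; have Lr : 1 <= L%:R :> R by rewrite ler1n.
case: n => [|n]; first by rewrite big_ord0 mulr_ge0.
(* Closed forms that pass through the induction: [sqrt (L / d)] is at most the increment of
   [2 sqrt (L n)], and [1 / (n + 1)^2 <= 1 / n - 1 / (n + 1)] telescopes beyond [L]. The first form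
   reaches [3 L] at [n = L]; the tail adds at most [7 L], hence the factor 10. *)
suff : \sum_(d < n.+1) majorant L d <=
    if (n <= L)%N then L%:R + 2 * Num.sqrt (L%:R * n%:R)
    else 10 * L%:R - 7 * L%:R ^+ 2 / n%:R.
  move=> /le_trans; apply; case: leqP => nL.
    have : Num.sqrt (L%:R * n%:R) <= Num.sqrt (L%:R * L%:R) :> R.
      by rewrite ler_wsqrtr// ler_wpM2l// ler_nat.
    rewrite -expr2 sqrtr_sqr ger0_norm// => h; lra.
  by rewrite gerBl divr_ge0// mulr_ge0// sqr_ge0.
elim: n => [|n IH]; first by rewrite big_ord1 /majorant/= mulr0 sqrtr0 mulr0 addr0.
rewrite big_ord_recr/=; apply: (le_trans (lerD IH (lexx _))) => {IH}.
rewrite /majorant/=.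
have n0 : 0 < n.+1%:R :> R by rewrite ltr0n.
case: (ltngtP n L) => nL.
- rewrite -addrA lerD2l -lerBrDl.
  set A : R := Num.sqrt (L%:R * n%:R).
  set B : R := Num.sqrt (L%:R * n.+1%:R).
  have B0 : 0 < B by rewrite sqrtr_gt0 mulr_gt0// ltr0n.
  have AB : A <= B by rewrite ler_wsqrtr// ler_wpM2l// ler_nat.
  have hB : B * (B - A) * 2 >= L%:R.
    have A2 : A ^+ 2 = L%:R * n%:R by rewrite sqr_sqrtr// mulr_ge0.
    have B2 : B ^+ 2 = L%:R * n%:R + L%:R by rewrite sqr_sqrtr ?mulr_ge0// -natr1 mulrDr mulr1.
    by nra.
  have -> : Num.sqrt (L%:R / n.+1%:R) = L%:R / B.
    apply: (mulIf (lt0r_neq0 B0)); rewrite divfK ?lt0r_neq0// -sqrtrM ?divr_ge0//.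
    rewrite (_ : _ / _ * _ = L%:R ^+ 2); last by field; rewrite gt_eqF.
    by rewrite sqrtr_sqr ger0_norm.
  by rewrite ler_pdivrMr//; lra.
- have nr : 0 < n%:R :> R by rewrite ltr0n (leq_ltn_trans _ nL).
  rewrite -addrA lerD2l addrC -lerBrDr opprK.
  rewrite addrC -mulrBr expr_div_n mulrA ler_wpM2l ?mulr_ge0 ?sqr_ge0// -natr1.
  have -> : n%:R^-1 - (n%:R + 1)^-1 = (n%:R * (n%:R + 1))^-1 :> R.
    by field; rewrite !gt_eqF// addr_gt0.
  by rewrite lef_pV2 ?posrE ?exprn_gt0 ?mulr_gt0 ?addr_gt0//; nra.
- rewrite nL -expr2 sqrtr_sqr ger0_norm// expr_div_n -subr_ge0.
  have lS : L.+1%:R = L%:R + 1 :> R by rewrite natr1.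
  rewrite lS; set l : R := L%:R in Lr *.
  have -> : 10 * l - 7 * l ^+ 2 / (l + 1) - (l + 2 * l + 7 * (l ^+ 2 / (l + 1) ^+ 2)) =
     7 * l / (l + 1) ^+ 2 by field; rewrite gt_eqF// addr_gt0// (lt_le_trans ltr01).
  by rewrite divr_ge0 ?sqr_ge0// mulr_ge0// (le_trans ler01).
Qed.

(* The natural number [(j - k) + (k - j)] is the distance [|j - k|]. *)
Lemma sum_majorant_dist L n j : (0 < L)%N -> (j < n)%N ->
  \sum_(k < n) majorant L ((j - k) + (k - j)) <= 20 * L%:R.
Proof.
move=> L0 jn.
rewrite -(big_mkord xpredT (fun k => majorant L ((j - k) + (k - j)))).
rewrite (@big_cat_nat _ _ _ j.+1)//= (_ : 20 = 10 + 10 :> R); last by lra.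
rewrite mulrDl lerD//.
  rewrite big_nat_rev/= (le_trans _ (sum_majorant_le j.+1 L0))//.
  rewrite -(big_mkord xpredT (majorant L)) big_nat [X in _ <= X]big_nat.
  apply: ler_sum => k /andP[_ kj]; rewrite add0n subSS.
  by rewrite (_ : (j - (j - k) + (j - k - j))%N = k)//; lia.
rewrite -{1}(add0n j.+1) big_addn.
rewrite (le_trans _ (sum_majorant_le (n - j.+1).+1 L0))//.
rewrite big_ord_recl/= -(big_mkord xpredT (fun k => majorant L k.+1)).
rewrite -[X in X <= _]add0r lerD ?majorant_ge0//.
apply: ler_sum => k _; rewrite (_ : (j - (k + j.+1) + (k + j.+1 - j))%N = k.+1)//; lia.
Qed.

End kernel_majorant.

(** * Domination of the inverse Sobolev weight by dyadic Gaussians *)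

Section dyadic_shells.
Context {R : realType}.
Implicit Types (l : R) (S : R -> R).

Local Notation mu := (@lebesgue_measure R).
Local Notation D := (@halfline R).
Local Notation Int f := (mu.-integrable D (EFin \o f)).
Local Notation I f := (Rintegral mu D f).
Local Notation mD := measurable_halfline.

Definition weight (alpha l : R) : R := (l ^+ 2 + 1) `^ alpha.

(** The number [4^-j], written as the inverse square of a natural number to match the parameter [L]
    of [gauss_kernel_le]. *)
Definition dyadic j : R := (2 ^ j)%N%:R ^- 2.

Lemma weight_gt0 alpha l : 0 < weight alpha l.
Proof. by rewrite powR_gt0// ltr_wpDl ?sqr_ge0. Qed.

Lemma measurable_weight alpha : measurable_fun D (weight alpha).
Proof.
apply: measurable_funTS; apply: (measurableT_comp (measurable_powR alpha)).
by apply: continuous_measurable_fun => l; apply: differentiable_continuous;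
  apply/derivable1_diffP; exact: ex_derive.
Qed.

Lemma measurable_inv_weight alpha : measurable_fun D (fun l => (weight alpha l)^-1).
Proof.
rewrite (_ : (fun l => _) = weight (- alpha)).
  exact: measurable_weight.
by apply/funext => l; rewrite /weight powRN.
Qed.

Lemma measurable_gauss r : measurable_fun D (gauss r : R -> R).
Proof. by apply: derivable_measurable => l; exact: ex_derive. Qed.

Lemma dyadic_gt0 j : 0 < dyadic j.
Proof. by rewrite invr_gt0 exprn_gt0// ltr0n expn_gt0. Qed.

Lemma dyadic_shell l : exists j, 4 ^+ j <= l ^+ 2 + 1 < 4 ^+ j.+1.
Proof.
have y1 : 1 <= l ^+ 2 + 1 by rewrite lerDr sqr_ge0.
have : exists m, l ^+ 2 + 1 < 4 ^+ m.
  have [n hn] : exists n, l ^+ 2 + 1 < n%:R.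
    by exists (Num.bound (l ^+ 2 + 1)); rewrite archi_boundP // (le_trans ler01 y1).
  by exists n; rewrite (lt_le_trans hn)// -natrX ler_nat ltnW// ltn_expl.
move=> h; case: (ex_minnP h) => -[|j] hj jmin.
  by move: hj; rewrite expr0 ltNge y1.
exists j; rewrite hj andbT leNgt; apply/negP => /jmin.
by rewrite ltnn.
Qed.

(** On the shell [4^j <= l^2 + 1 < 4^(j+1)] the exponent [4^-j l^2] is below 4, so the Gaussian is
    at least [e^-4]; this is the origin of [expR 4]. *)
Lemma inv_weight_le alpha l : 0 < alpha -> exists j,
  (weight alpha l)^-1 <= expR 4 * ((4 `^ alpha)^-1 ^+ j * gauss (dyadic j) l).
Proof.
move=> a0; have [j /andP[j1 j2]] := dyadic_shell l; exists j.
have q0 : 0 < 4 `^ alpha :> R by rewrite powR_gt0.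
rewrite mulrCA -[X in X <= _]mulr1 ler_pM ?invr_ge0 ?(ltW (weight_gt0 _ _))//.
- rewrite exprVn lef_pV2 ?posrE ?weight_gt0 ?exprn_gt0//.
  rewrite -powR_mulrn ?powR_ge0// -powRrM mulrC powRrM powR_mulrn//.
  by apply: ge0_ler_powR => //; rewrite ?nnegrE ?(ltW a0) ?exprn_ge0// addr_ge0 ?sqr_ge0.
- rewrite /gauss -expRD -[X in X <= _]expR0 ler_expR subr_ge0 /dyadic mulrC.
  rewrite ler_pdivrMr ?exprn_gt0 ?ltr0n ?expn_gt0//.
  rewrite natrX -exprM mulnC exprM (_ : 2 ^+ 2 = 4 :> R); last by rewrite -natrX.
  by move: j2; rewrite [4 ^+ _]exprS => j2; lra.
Qed.

Lemma lt_2_powR4 alpha : 2^-1 < alpha -> 2 < 4 `^ alpha :> R.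
Proof.
move=> a1; rewrite (_ : 4 = 2 `^ 2 :> R); last by rewrite powR_mulrn// -natrX.
rewrite -powRrM -[X in X < _](@powRr1 _ 2)//.
by rewrite /powR gt_eqF// ltr_expR ltr_pM2r ?ln_gt0 ?ltr1n//; lra.
Qed.

(** Here [alpha > 1/2] enters: the bounds [4^(-j alpha) B 2^j] form a geometric series of ratio
    [2 / 4^alpha < 1]. *)
Lemma integral_inv_weight_le alpha S (B : R) : 2^-1 < alpha -> measurable_fun D S ->
  (forall l, 0 < l -> 0 <= S l) ->
  (forall j, (\int[mu]_(l in D) (gauss (dyadic j) l * S l)%:E <= (B * 2 ^+ j)%:E)%E) ->
  (\int[mu]_(l in D) ((weight alpha l)^-1 * S l)%:E <=
     (expR 4 / (1 - 2 / 4 `^ alpha) * B)%:E)%E.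
Proof.
move=> a1 mS S0 hB.
have a0 : 0 < alpha by rewrite (lt_trans _ a1).
have q2 := lt_2_powR4 a1.
set rho := 2 / 4 `^ alpha.
have q0 : 0 < 4 `^ alpha by rewrite (lt_trans _ q2).
have rho0 : 0 <= rho by rewrite divr_ge0// ltW.
have rho1 : rho < 1 by rewrite ltr_pdivrMr// mul1r.
have B0 : 0 <= B.
  rewrite -lee_fin (le_trans _ (le_trans (hB 0) _))//; last by rewrite expr0 mulr1.
  by apply: integral_ge0 => l /in_halfline l0; rewrite lee_fin mulr_ge0 ?gauss_ge0 ?S0.
pose u j l := (expR 4 * (4 `^ alpha)^-1 ^+ j * (gauss (dyadic j) l * S l))%:E.
have c0 j : 0 <= expR 4 * (4 `^ alpha)^-1 ^+ j.
  by rewrite mulr_ge0 ?expR_ge0// exprn_ge0// invr_ge0 ltW.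
have u0 j l : D l -> (0 <= u j l)%E.
  by move=> /in_halfline l0; rewrite lee_fin mulr_ge0// mulr_ge0 ?gauss_ge0 ?S0.
have mu' j : measurable_fun D (u j).
  apply/measurable_EFinP; apply: measurable_funM => //.
  by apply: measurable_funM => //; exact: measurable_gauss.
apply: (@le_trans _ _ (\int[mu]_(l in D) \sum_(j <oo) u j l)%E).
  apply: ge0_le_integral => //.
  - exact: mD.
  - move=> l /in_halfline l0; rewrite lee_fin mulr_ge0 ?S0// invr_ge0 ltW//.
    exact: weight_gt0.
  - by apply/measurable_EFinP/measurable_funM => //; exact: measurable_inv_weight.
  - by apply: (@ge0_emeasurable_sum _ _ _ D u xpredT) => [j l Dl _|j _]; [exact: u0|exact: mu'].
  - move=> l Dl; have /in_halfline l0 := Dl.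
    (* The term of the shell containing [l] suffices; the other terms of the series are
       nonnegative. *)
    have [j hj] := inv_weight_le l a0.
    apply: (@le_trans _ _ (u j l)).
      rewrite lee_fin (le_trans (ler_wpM2r _ hj)) ?S0//.
      by rewrite !mulrA.
    apply: (le_trans _ (nneseries_lim_ge j.+1 (fun n _ _ => u0 n l Dl))).
    rewrite big_nat_recr//= leeDr//.
    by apply: sume_ge0 => i _; exact: u0.
rewrite integral_nneseries//; last exact: mD.
apply: (@le_trans _ _ (\sum_(j <oo) (expR 4 * B * rho ^+ j)%:E)%E).
  apply: lee_nneseries => [j _ _|j _]; first by apply: integral_ge0 => l /u0.
  rewrite /u; under eq_integral do rewrite EFinM.
  rewrite ge0_integralZl_EFin//.
  - apply: (le_trans (lee_wpmul2l _ (hB j))); first by rewrite lee_fin.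
    rewrite -EFinM lee_fin /rho expr_div_n exprVn.
    by rewrite [leLHS](_ : _ = expR 4 * B * (2 ^+ j / 4 `^ alpha ^+ j))//; ring.
  - exact: mD.
  - by move=> l /in_halfline l0; rewrite lee_fin mulr_ge0 ?gauss_ge0 ?S0.
  - by apply/measurable_EFinP/measurable_funM => //; exact: measurable_gauss.
apply: lime_le.
  by apply: is_cvg_nneseries => j _ _; rewrite lee_fin mulr_ge0 ?mulr_ge0 ?expR_ge0// exprn_ge0.
apply: nearW => n; rewrite sumEFin lee_fin -big_distrr/=.
have := @geometric_seriesE R 1 rho; rewrite lt_eqF// => /(_ isT).
move=> /(congr1 (fun f => f n)); rewrite /series/= /geometric.
under eq_bigr do rewrite mul1r.
move=> ->; rewrite mul1r [leRHS]mulrAC ler_wpM2l ?mulr_ge0 ?expR_ge0//.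
rewrite -[leRHS]mul1r ler_wpM2r ?invr_ge0 ?subr_ge0 ?(ltW rho1)//.
by rewrite gerBl exprn_ge0.
Qed.
End dyadic_shells.

(** * The maximal inequality at points of unit separation with arbitrary times *)

Section discrete_maximal_inequality.
Context {R : realType}.
Implicit Types (l r s : R) (Gr Gi : R -> R).

Local Notation mu := (@lebesgue_measure R).
Local Notation D := (@halfline R).
Local Notation Int f := (mu.-integrable D (EFin \o f)).
Local Notation I f := (Rintegral mu D f).
Local Notation mD := measurable_halfline.

Lemma integrable_half_sum (T : Type) (e : seq T) (f : T -> R -> R) :
  (forall i, Int (f i)) -> Int (fun l => \sum_(i <- e) f i l).
Proof.
move=> intf; elim: e => [|i e IH].
  under [fun l => _]eq_fun do rewrite big_nil.
  exact: (@integrable0 _ _ _ mu D).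
under [fun l => _]eq_fun do rewrite big_cons.
exact: integrable_halfD.
Qed.

Lemma Rintegral_half_sum (T : Type) (e : seq T) (f : T -> R -> R) :
  (forall i, Int (f i)) ->
  I (fun l => \sum_(i <- e) f i l) = \sum_(i <- e) I (f i).
Proof.
move=> intf; elim: e => [|i e IH].
  under eq_Rintegral do rewrite big_nil.
  by rewrite big_nil Rintegral_cst ?mul0r//; exact: mD.
under eq_Rintegral do rewrite big_cons.
by rewrite Rintegral_halfD ?big_cons ?IH//; exact: integrable_half_sum.
Qed.

Lemma normr_dot_le (p q p' q' : R) :
  `|p * p' + q * q'| <= (p ^+ 2 + q ^+ 2 + (p' ^+ 2 + q' ^+ 2)) / 2.
Proof.
have := sqr_ge0 (p + p'); have := sqr_ge0 (p - p').
have := sqr_ge0 (q + q'); have := sqr_ge0 (q - q').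
by rewrite ler_norml => *; apply/andP; split; nra.
Qed.

Lemma le_pairing (c p q g h : R) : 0 < c ->
  p * g + q * h <= (c * (p ^+ 2 + q ^+ 2) + c^-1 * (g ^+ 2 + h ^+ 2)) / 2.
Proof.
move=> c0; have c1 : c != 0 by rewrite gt_eqF.
rewrite -subr_ge0.
have -> : (c * (p ^+ 2 + q ^+ 2) + c^-1 * (g ^+ 2 + h ^+ 2)) / 2 - (p * g + q * h) =
  ((c * p - g) ^+ 2 + (c * q - h) ^+ 2) / (2 * c) by field.
by rewrite divr_ge0 ?addr_ge0 ?sqr_ge0 ?mulr_ge0// ltW.
Qed.

(** With [evol_im], the real and imaginary parts of the sine integral of
    [e^(i t (l^2 + 1)) (Gr + i Gi)], that is, of [sinh s] times the Schrodinger evolution. *)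
Definition evol_re Gr Gi t s : R :=
  I (fun l => sin (l * s) * (cos (t * (l ^+ 2 + 1)) * Gr l - sin (t * (l ^+ 2 + 1)) * Gi l)).
Definition evol_im Gr Gi t s : R :=
  I (fun l => sin (l * s) * (cos (t * (l ^+ 2 + 1)) * Gi l + sin (t * (l ^+ 2 + 1)) * Gr l)).

Lemma integrable_half_bddM (h g : R -> R) : (forall l, derivable h l 1) ->
  (forall l, `|h l| <= 1) -> Int g -> Int (fun l => h l * g l).
Proof.
move=> dh h1 intg.
apply: (@le_integrable_half _ _ (fun l => `|g l|)).
- apply: measurable_funM; first exact: derivable_measurable.
  by apply/measurable_EFinP; exact: (measurable_int mu).
- by move=> l _; rewrite normrM ler_piMl.
- exact: (@integrable_norm _ _ _ mu).
Qed.

Lemma integrable_evol_re Gr Gi t s : Int Gr -> Int Gi ->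
  Int (fun l => sin (l * s) * (cos (t * (l ^+ 2 + 1)) * Gr l - sin (t * (l ^+ 2 + 1)) * Gi l)).
Proof.
move=> hr hi; apply: integrable_half_bddM => [l|l|]; [exact: ex_derive|exact: normr_sin|].
apply: integrable_halfB; apply: integrable_half_bddM => [l|l|].
- exact: ex_derive.
- exact: normr_cos.
- by [].
- exact: ex_derive.
- exact: normr_sin.
- by [].
Qed.

Lemma integrable_evol_im Gr Gi t s : Int Gr -> Int Gi ->
  Int (fun l => sin (l * s) * (cos (t * (l ^+ 2 + 1)) * Gi l + sin (t * (l ^+ 2 + 1)) * Gr l)).
Proof.
move=> hr hi; apply: integrable_half_bddM => [l|l|]; [exact: ex_derive|exact: normr_sin|].
apply: integrable_halfD; apply: integrable_half_bddM => [l|l|].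
- exact: ex_derive.
- exact: normr_cos.
- by [].
- exact: ex_derive.
- exact: normr_sin.
- by [].
Qed.

Section quadratic_form.
Variables (n : nat) (x t a b : nat -> R).

(** [P + i Q] is the sum of [sin (l x_k) e^(- i t_k (l^2 + 1)) (a_k + i b_k)]: the adjoint operator
    applied to the vector [a + i b]. *)
Let P l := \sum_(k < n) sin (l * x k) *
  (a k * cos (t k * (l ^+ 2 + 1)) + b k * sin (t k * (l ^+ 2 + 1))).
Let Q l := \sum_(k < n) sin (l * x k) *
  (b k * cos (t k * (l ^+ 2 + 1)) - a k * sin (t k * (l ^+ 2 + 1))).
Let u j k := ((a j * a k + b j * b k) * cos (t j - t k)
  - (a j * b k - b j * a k) * sin (t j - t k)) / 2.
Let v j k := - ((a j * a k + b j * b k) * sin (t j - t k)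
  + (a j * b k - b j * a k) * cos (t j - t k)) / 2.
Let c0 r t x l := gauss r l * (cos (t * l ^+ 2) * cos (l * x)).
Let s0 r t x l := gauss r l * (sin (t * l ^+ 2) * cos (l * x)).
Let T r j k l :=
  u j k * (c0 r (t j - t k) (x j - x k) l - c0 r (t j - t k) (x j + x k) l) +
  v j k * (s0 r (t j - t k) (x j - x k) l - s0 r (t j - t k) (x j + x k) l).

(** The product of two sines is half a difference of cosines, so kernels appear at both [x j - x k]
    and [x j + x k], and separation is required of both. The unit in [l^2 + 1] only rotates the
    coefficients by the angle [t j - t k]; the rotated coefficients are [u] and [v]. *)
Lemma sqr_trig_sumE r l :
  gauss r l * (P l ^+ 2 + Q l ^+ 2) = \sum_(j < n) \sum_(k < n) T r j k l.
Proof.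
rewrite /P /Q [X in _ * (X + _)]expr2 [X in _ * (_ + X)]expr2.
rewrite !big_distrlr/= -big_split/= mulr_sumr; apply: eq_bigr => j _.
rewrite -big_split/= mulr_sumr; apply: eq_bigr => k _.
rewrite /T /c0 /s0 /u /v.
set z := t j - t k; set y := l ^+ 2.
have E1 : cos (z * y) * cos z - sin (z * y) * sin z =
    cos (t j * (y + 1)) * cos (t k * (y + 1)) + sin (t j * (y + 1)) * sin (t k * (y + 1)).
  by rewrite -cosD -cosB; congr cos; rewrite /z; ring.
have E2 : sin (z * y) * cos z + cos (z * y) * sin z =
    sin (t j * (y + 1)) * cos (t k * (y + 1)) - cos (t j * (y + 1)) * sin (t k * (y + 1)).
  by rewrite -sinD -sinB; congr sin; rewrite /z; ring.
have -> : cos (l * (x j - x k)) =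
    cos (l * x j) * cos (l * x k) + sin (l * x j) * sin (l * x k).
  by rewrite mulrBr cosB.
have -> : cos (l * (x j + x k)) =
    cos (l * x j) * cos (l * x k) - sin (l * x j) * sin (l * x k).
  by rewrite mulrDr cosD.
transitivity (gauss r l * (sin (l * x j) * sin (l * x k)) *
   ((a j * a k + b j * b k) * (cos (z * y) * cos z - sin (z * y) * sin z)
    - (a j * b k - b j * a k) * (sin (z * y) * cos z + cos (z * y) * sin z))).
  by rewrite E1 E2; ring.
by field.
Qed.

Hypothesis t01 : forall k, 0 < t k < 1.
Hypothesis x_dist : forall j k, ((j - k) + (k - j))%N%:R <= `|x j - x k|.
Hypothesis x_sum : forall j k, ((j - k) + (k - j))%N%:R <= `|x j + x k|.

Let V := \sum_(k < n) (a k ^+ 2 + b k ^+ 2).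

Let integrable_T r j k : 0 < r -> Int (T r j k).
Proof.
move=> r0; apply: integrable_halfD; apply: integrable_halfZ; apply: integrable_halfB.
- exact: integrable_c0.
- exact: integrable_c0.
- exact: integrable_s0.
- exact: integrable_s0.
Qed.

Let Rintegral_T r j k : 0 < r -> I (T r j k) =
  u j k * (gcos r (t j - t k) (x j - x k) - gcos r (t j - t k) (x j + x k)) +
  v j k * (gsin r (t j - t k) (x j - x k) - gsin r (t j - t k) (x j + x k)).
Proof.
move=> r0.
have c y := integrable_c0 r0 (t j - t k) y.
have s y := integrable_s0 r0 (t j - t k) y.
rewrite /T Rintegral_halfD; last 2 first.
- by apply: integrable_halfZ; apply: integrable_halfB; exact: c.
- by apply: integrable_halfZ; apply: integrable_halfB; exact: s.
rewrite !Rintegral_halfZ; last 2 first.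
- by apply: integrable_halfB; exact: s.
- by apply: integrable_halfB; exact: c.
by rewrite !Rintegral_halfB//; try exact: c; exact: s.
Qed.

(** With [M] the majorant and [N] the sum of squares on the right, [u] and [v] are at most [N / 2]
    by the arithmetic-geometric inequality, and each of the two kernel differences is at most
    [2 M]. *)
Lemma Rintegral_T_le m j k :
  I (T (dyadic m) j k) <= 2 * majorant (2 ^ m) ((j - k) + (k - j)) *
    ((a j ^+ 2 + b j ^+ 2) + (a k ^+ 2 + b k ^+ 2)).
Proof.
rewrite Rintegral_T ?dyadic_gt0//.
have L0 : (0 < 2 ^ m)%N by rewrite expn_gt0.
have t1 : `|t j - t k| <= 1.
  by have /andP[? ?] := t01 j; have /andP[? ?] := t01 k; rewrite ler_norml; lra.
set M := majorant _ _.
have hc y : ((j - k) + (k - j))%N%:R <= `|y| -> `|gcos (dyadic m) (t j - t k) y| <= M.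
  by move=> hy; apply: (gauss_kernel_le L0 t1 hy); left.
have hs y : ((j - k) + (k - j))%N%:R <= `|y| -> `|gsin (dyadic m) (t j - t k) y| <= M.
  by move=> hy; apply: (gauss_kernel_le L0 t1 hy); right.
move: (hc _ (x_dist j k)) (hc _ (x_sum j k)) (hs _ (x_dist j k)) (hs _ (x_sum j k)).
move: (gcos _ _ _) (gcos _ _ _) (gsin _ _ _) (gsin _ _ _) => A B A' B' hA hB hA' hB'.
have M0 : 0 <= M by exact: majorant_ge0.
set N := (a j ^+ 2 + b j ^+ 2) + (a k ^+ 2 + b k ^+ 2).
have h1 : `|a j * a k + b j * b k| <= N / 2.
  exact: normr_dot_le.
have h2 : `|a j * b k - b j * a k| <= N / 2.
  by rewrite -mulNr (le_trans (normr_dot_le _ _ _ _))// sqrrN /N; lra.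
have trig (p q c s : R) : `|p| <= N / 2 -> `|q| <= N / 2 -> `|c| <= 1 -> `|s| <= 1 ->
    `|(p * c + q * s) / 2| <= N / 2.
  move=> hp hq hcc hss; rewrite normrM [`|2^-1|]ger0_norm// ler_pM2r//.
  rewrite (le_trans (ler_normD _ _))// !normrM.
  have := ler_pM (normr_ge0 p) (normr_ge0 c) hp hcc.
  have := ler_pM (normr_ge0 q) (normr_ge0 s) hq hss.
  by rewrite !mulr1 => ? ?; lra.
have hu : `|u j k| <= N / 2.
  by rewrite /u -mulrN; apply: trig; rewrite ?normrN ?normr_cos ?normr_sin.
have hv : `|v j k| <= N / 2.
  rewrite /v mulNr normrN; apply: trig; rewrite ?normr_cos ?normr_sin//.
have bd (p q q' : R) : `|p| <= N / 2 -> `|q| <= M -> `|q'| <= M -> p * (q - q') <= M * N.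
  move=> hp hq hq'; rewrite (le_trans (ler_norm _))// normrM.
  have h : `|q - q'| <= M + M by rewrite (le_trans (ler_normB _ _))// lerD.
  by have := ler_pM (normr_ge0 p) (normr_ge0 _) hp h; lra.
by have := bd _ _ _ hu hA hB; have := bd _ _ _ hv hA' hB'; lra.
Qed.

Lemma integrable_gauss_PQ m : Int (fun l => gauss (dyadic m) l * (P l ^+ 2 + Q l ^+ 2)).
Proof.
under [fun l => _]eq_fun do rewrite sqr_trig_sumE.
apply: integrable_half_sum => j; apply: integrable_half_sum => k.
by apply: integrable_T; exact: dyadic_gt0.
Qed.

(** Schur test: by symmetry of the distance, the [N j] and the [N k] halves each contribute
    [2 * 20 * 2^m * V], whence 80. *)
Lemma quadratic_form_le m :
  I (fun l => gauss (dyadic m) l * (P l ^+ 2 + Q l ^+ 2)) <= 80 * V * 2 ^+ m.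
Proof.
under eq_Rintegral do rewrite sqr_trig_sumE.
have dm := @dyadic_gt0 R m.
rewrite Rintegral_half_sum => [|j]; last first.
  by apply: integrable_half_sum => k; exact: integrable_T.
rewrite (eq_bigr (fun j : 'I_n => \sum_(k < n) I (T (dyadic m) j k))); last first.
  by move=> j _; rewrite Rintegral_half_sum// => k; exact: integrable_T.
have L0 : (0 < 2 ^ m)%N by rewrite expn_gt0.
pose M j k : R := majorant (2 ^ m) ((j - k) + (k - j)).
pose N k := a k ^+ 2 + b k ^+ 2.
have N0 k : 0 <= N k by rewrite addr_ge0 ?sqr_ge0.
have MN : \sum_(j < n) \sum_(k < n) M j k * N j <= 20 * 2 ^+ m * V.
  rewrite /V mulr_sumr; apply: ler_sum => j _.
  by rewrite -mulr_suml ler_wpM2r// -natrX; exact: sum_majorant_dist.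
apply: (@le_trans _ _ (\sum_(j < n) \sum_(k < n) (2 * (M j k * N j) + 2 * (M k j * N k)))).
  apply: ler_sum => j _; apply: ler_sum => k _.
  rewrite (le_trans (Rintegral_T_le m j k))// /M (addnC (k - j)%N).
  by rewrite mulrDr !mulrA.
under eq_bigr do rewrite big_split/=.
rewrite big_split/= [X in _ + X]exchange_big/=.
under eq_bigr do rewrite -mulr_sumr.
rewrite -mulr_sumr; lra.
Qed.

Let derivable_P l : derivable P l 1.
Proof.
rewrite (_ : P = \sum_(k < n) (fun l => sin (l * x k) *
  (a k * cos (t k * (l ^+ 2 + 1)) + b k * sin (t k * (l ^+ 2 + 1))))).
  by apply: derivable_sum => k; exact: ex_derive.
by apply/funext => y; rewrite fct_sumE.
Qed.

Let derivable_Q l : derivable Q l 1.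
Proof.
rewrite (_ : Q = \sum_(k < n) (fun l => sin (l * x k) *
  (b k * cos (t k * (l ^+ 2 + 1)) - a k * sin (t k * (l ^+ 2 + 1))))).
  by apply: derivable_sum => k; exact: ex_derive.
by apply/funext => y; rewrite fct_sumE.
Qed.

Variables (alpha : R) (Gr Gi : R -> R).
Hypothesis alpha1 : 2^-1 < alpha.
Hypothesis intGr : Int Gr.
Hypothesis intGi : Int Gi.
Hypothesis intG : Int (fun l => weight alpha l * (Gr l ^+ 2 + Gi l ^+ 2)).

Let C : R := expR 4 / (1 - 2 / 4 `^ alpha).

Let S l := P l ^+ 2 + Q l ^+ 2.

Let S0 l : 0 <= S l. Proof. by rewrite addr_ge0 ?sqr_ge0. Qed.

Let measurable_S : measurable_fun D S.
Proof.
have mP := derivable_measurable derivable_P.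
have mQ := derivable_measurable derivable_Q.
exact: measurable_funD (measurable_funX 2 mP) (measurable_funX 2 mQ).
Qed.

Let integral_inv_weight_S :
  (\int[mu]_(l in D) ((weight alpha l)^-1 * S l)%:E <= (C * (80 * V))%:E)%E.
Proof.
apply: integral_inv_weight_le => //= m.
by rewrite integral_half_EFin ?lee_fin ?quadratic_form_le//; exact: integrable_gauss_PQ.
Qed.

Let integrable_inv_weight_S : Int (fun l => (weight alpha l)^-1 * S l).
Proof.
apply/integrableP; split.
  by apply/measurable_EFinP/measurable_funM => //; exact: measurable_inv_weight.
under eq_integral => l _.
  rewrite /= ger0_norm; first over.
  by rewrite mulr_ge0// invr_ge0 ltW// weight_gt0.
by rewrite (le_lt_trans integral_inv_weight_S)// ltry.
Qed.

Hypothesis a_evol : forall k, a k = evol_re Gr Gi (t k) (x k).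
Hypothesis b_evol : forall k, b k = evol_im Gr Gi (t k) (x k).

Let C0 : 0 < C.
Proof.
rewrite divr_gt0 ?expR_gt0// subr_gt0 ltr_pdivrMr ?powR_gt0// mul1r.
exact: lt_2_powR4.
Qed.

(* The [T T^*] argument: [V = int (P Gr + Q Gi)] is split by the weight, and the
   part with [P^2 + Q^2] is a quadratic form bounded by a multiple of [V]. *)
Lemma sum_sqr_evol_le :
  V <= 80 * C * I (fun l => weight alpha l * (Gr l ^+ 2 + Gi l ^+ 2)).
Proof.
pose re k l := sin (l * x k) *
  (cos (t k * (l ^+ 2 + 1)) * Gr l - sin (t k * (l ^+ 2 + 1)) * Gi l).
pose im k l := sin (l * x k) *
  (cos (t k * (l ^+ 2 + 1)) * Gi l + sin (t k * (l ^+ 2 + 1)) * Gr l).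
have intre k : Int (re k) by exact: integrable_evol_re.
have intim k : Int (im k) by exact: integrable_evol_im.
have intk k : Int (fun l => a k * re k l + b k * im k l).
  by apply: integrable_halfD; apply: integrable_halfZ.
have VE : V = I (fun l => \sum_(k < n) (a k * re k l + b k * im k l)).
  rewrite Rintegral_half_sum => [|k]; last exact: intk.
  apply: eq_bigr => k _.
  rewrite Rintegral_halfD; [|exact: integrable_halfZ|exact: integrable_halfZ].
  rewrite !Rintegral_halfZ; [|exact: intim|exact: intre].
  by rewrite -/(evol_re _ _ _ _) -/(evol_im _ _ _ _) -a_evol -b_evol !expr2.
set K := 80 * C; set N := I _.
have K0 : 0 < K by rewrite mulr_gt0.
have intS := integrable_inv_weight_S.
(* Absorption: [K = 80 C] is chosen so that the part with [P^2 + Q^2] is at most [V]. Then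
   [V <= (V + K N) / 2], which gives [V <= K N]. *)
suff : V <= (K^-1 * I (fun l => (weight alpha l)^-1 * S l) + K * N) / 2.
  have : K^-1 * I (fun l => (weight alpha l)^-1 * S l) <= V.
    rewrite ler_pdivrMl// -lee_fin -integral_half_EFin//.
    by rewrite (le_trans integral_inv_weight_S)// /K mulrCA mulrA.
  by move: (K^-1 * _) (K * _) V => z y v' h1 h2; lra.
have -> : (K^-1 * I (fun l => (weight alpha l)^-1 * S l) + K * N) / 2 =
   I (fun l => 2^-1 * (K^-1 * ((weight alpha l)^-1 * S l) +
          K * (weight alpha l * (Gr l ^+ 2 + Gi l ^+ 2)))).
  rewrite Rintegral_halfZ; last by apply: integrable_halfD; exact: integrable_halfZ.
  rewrite Rintegral_halfD; [|exact: integrable_halfZ|exact: integrable_halfZ].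
  by rewrite !Rintegral_halfZ// mulrC.
rewrite VE; apply: le_Rintegral_half.
- exact: integrable_half_sum.
- by apply: integrable_halfZ; apply: integrable_halfD; exact: integrable_halfZ.
- move=> l _.
  have -> : \sum_(k < n) (a k * re k l + b k * im k l) = P l * Gr l + Q l * Gi l.
    rewrite /P /Q !mulr_suml -big_split/=; apply: eq_bigr => k _.
    by rewrite /re /im; ring.
  have w0 := weight_gt0 alpha l.
  have := @le_pairing (K^-1 * (weight alpha l)^-1) (P l) (Q l) (Gr l) (Gi l).
  rewrite mulr_gt0 ?invr_gt0// => /(_ isT) /le_trans; apply.
  have -> : (K^-1 * (weight alpha l)^-1)^-1 = K * weight alpha l.
    by rewrite invfM !invrK.
  rewrite /S; move: (weight alpha l)^-1 K^-1 => w' K'.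
  by rewrite -!mulrA [leRHS]mulrC.
Qed.

End quadratic_form.
End discrete_maximal_inequality.

(** * From sums over shifted integers to integrals over the half-line *)

Section lattice_integral.
Import HBNNSimple.
Context {R : realType}.

Local Notation mu := (@lebesgue_measure R).
Local Notation D := (@halfline R).
Local Notation mD := measurable_halfline.

Definition translate (c : R) (x : measurableTypeR R) : measurableTypeR R := x + c.

Lemma measurable_translate c : measurable_fun setT (translate c).
Proof. by apply: measurable_funD => //; exact: measurable_cst. Qed.

HB.instance Definition _ c :=
  isMeasurableFun.Build _ _ _ _ (translate c) (measurable_translate c).

Lemma lebesgue_measure_translate c (A : set R) : measurable A ->
  pushforward mu (translate c) A = mu A.
Proof.
move=> mA; apply/esym/lebesgue_measure_unique => //= _ [[a b]] _ <-.
rewrite /pushforward (_ : _ @^-1` _ = `]a - c, b - c]%classic); last first.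
  by apply/seteqP; split => x /=; rewrite /translate !in_itv/= ltrBlDr lerBrDr.
rewrite !lebesgue_measure_itv/= !lte_fin ltrD2r.
by case: ifP => // _; rewrite -!EFinB; congr EFin; ring.
Qed.

Lemma integral_translate (a b c : R) (f : R -> \bar R) :
  measurable_fun setT f -> (forall x, (0 <= f x)%E) ->
  (\int[mu]_(x in `](a + c)%R, (b + c)%R]) f x = \int[mu]_(x in `]a, b]) f (x + c)%R)%E.
Proof.
move=> mf f0; rewrite (_ : `]a, b]%classic = translate c @^-1` `]a + c, b + c]); last first.
  by apply/seteqP; split => x /=; rewrite /translate !in_itv/= ltrD2r lerD2r.
rewrite -(@ge0_integral_pushforward _ _ _ _ _ (translate c) _ mu _ f)//.
- by apply: eq_measure_integral => A mA _; exact/esym/lebesgue_measure_translate.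
- exact: measurable_funTS.
Qed.

Lemma halfline_bigcup : D = \bigcup_k `]k%:R, k.+1%:R]%classic.
Proof.
apply/seteqP; split => x; last first.
  by move=> [k _] /=; rewrite in_itv/= => /andP[kx _]; apply/in_halfline; exact: le_lt_trans kx.
move=> /in_halfline x0.
have : exists m, x <= m%:R by exists (Num.bound x); rewrite ltW// archi_boundP// ltW.
move=> h; case: (ex_minnP h) => -[|k] hk kmin.
  by move: hk; rewrite leNgt x0.
exists k => //=; rewrite in_itv/= hk andbT ltNge; apply/negP => /kmin.
by rewrite ltnn.
Qed.

Lemma trivIset_unit_cells : trivIset setT (fun k => `](k%:R : R), k.+1%:R]%classic).
Proof.
apply/trivIsetP => i j _ _ ij; apply/seteqP; split => // x /=.
rewrite !in_itv/= => -[/andP[ix xi] /andP[jx xj]].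
have := lt_le_trans ix xj; have := lt_le_trans jx xi.
by rewrite !ltr_nat; lia.
Qed.

(* The integral of a nonnegative function is a supremum over the simple
   functions below it, and these can be integrated cell by cell. *)
Lemma integral_le_lattice (f : R -> \bar R) (B : R) :
  (forall x, 0 < x -> (0 <= f x)%E) ->
  (forall (th : R) n (h : nat -> R), 0 < th ->
     (forall k, ((h k)%:E <= f (th + k%:R)%R)%E) -> \sum_(k < n) h k <= B) ->
  (\int[mu]_(x in D) f x <= B%:E)%E.
Proof.
move=> f0 hB.
rewrite ge0_integralE; last by move=> x /in_halfline; exact: f0.
apply: ge_ereal_sup => _ [h /= hf <-].
have hD : h \_ D = h.
  apply/funext => x; rewrite patchE; case: ifPn => // /negP xD.
  apply/eqP; rewrite eq_sym eq_le fun_ge0 andbT -lee_fin (le_trans (hf x))//.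
  by rewrite patchE; case: ifPn.
rewrite -hD -integral_nnsfun; last exact: mD.
have mh : measurable_fun setT (EFin \o h) by exact/measurable_EFinP.
have h0 x : (0 <= (h x)%:E)%E by rewrite lee_fin fun_ge0.
rewrite halfline_bigcup ge0_integral_bigcup//=; last 2 first.
- exact: measurable_funTS.
- exact: trivIset_unit_cells.
apply: lime_le; first by apply: is_cvg_nneseries => k _ _; exact: integral_ge0.
apply: nearW => n; rewrite big_mkord.
have cell k : (\int[mu]_(x in `]k%:R, k.+1%:R]) (h x)%:E =
    \int[mu]_(x in `]0%R, 1%R]) (h (x + k%:R)%R)%:E)%E.
  rewrite -(@integral_translate 0 1 k%:R (EFin \o h))//.
  by rewrite add0r addrC natr1.
under eq_bigr do rewrite cell.
have mhk k : measurable_fun (`](0 : R), 1]%classic : set R) (fun x : R => (h (x + k%:R)%R)%:E).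
  apply: measurable_funTS; apply/measurable_EFinP.
  exact: (measurableT_comp (measurable_funPT h) (measurable_translate k%:R)).
rewrite -ge0_integral_sum//; last by move=> k; exact: mhk.
apply: (@le_trans _ _ (\int[mu]_(x in `]0%R, 1%R]) (cst B%:E) x)%E); last first.
  rewrite integral_cst; last exact: measurable_itv.
  rewrite [X in (_ * X)%E](_ : _ = 1%E) ?mule1//.
  by rewrite [LHS](@lebesgue_measure_itv R `]0, 1])/= lte_fin ltr01 sube0.
apply: ge0_le_integral => //.
- by move=> x _; apply: sume_ge0 => k _.
- by apply: emeasurable_sum => k; exact: mhk.
- move=> x /=; rewrite in_itv/= => /andP[x0 _]; rewrite sumEFin lee_fin.
  apply: (hB x n (fun k => h (x + k%:R)) x0) => k.
  rewrite (le_trans (hf _))// patchE; case: ifPn => // _; apply: f0.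
  exact: ltr_wpDr.
Qed.

End lattice_integral.

(** * Reduction of the spherical transform and of the evolution to sine integrals *)

Section schwartz_functions.
Context {R : realType}.
Implicit Types (f : R -> R[i]) (l s t : R).

Local Notation mu := (@lebesgue_measure R).
Local Notation D := (@halfline R).
Local Notation Int f := (mu.-integrable D (EFin \o f)).
Local Notation I f := (Rintegral mu D f).
Local Notation mD := measurable_halfline.

Lemma sinh_gt0 s : 0 < s -> 0 < sinh s.
Proof. by move=> s0; rewrite divr_gt0// subr_gt0 ltr_expR gt0_cp. Qed.

Lemma sinh_le_expR s : sinh s <= expR s.
Proof. by rewrite /sinh ler_pdivrMr//; have := expR_ge0 s; have := expR_ge0 (- s); lra. Qed.

Lemma continuous_sinh : continuous (@sinh R).
Proof.
by move=> s; apply: differentiable_continuous; apply/derivable1_diffP;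
  rewrite /sinh; exact: ex_derive.
Qed.

Lemma normr_Re_le (z : R[i]) : `|complex.Re z| <= normc z.
Proof.
case: z => a b /=; rewrite -(sqrtr_sqr a) ler_wsqrtr// lerDl sqr_ge0//.
Qed.

Lemma normr_Im_le (z : R[i]) : `|complex.Im z| <= normc z.
Proof.
case: z => a b /=; rewrite -(sqrtr_sqr b) ler_wsqrtr// lerDr sqr_ge0//.
Qed.

Lemma sqr_normc (z : R[i]) : normc z ^+ 2 = complex.Re z ^+ 2 + complex.Im z ^+ 2.
Proof. by case: z => a b /=; rewrite sqr_sqrtr// addr_ge0 ?sqr_ge0. Qed.

(** The case [S = 1] of [integral_inv_weight_le]: the Gaussian of parameter [4^-j] has half-line
    integral [2^j sqrt pi / 2], at most [2^j]. *)
Lemma integrable_inv_weight alpha : 2^-1 < alpha -> Int (fun l => (weight alpha l)^-1).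
Proof.
move=> a1; apply/integrableP; split.
  by apply/measurable_EFinP; exact: measurable_inv_weight.
have := @integral_inv_weight_le R alpha (cst 1) 1 a1.
move=> /(_ (measurable_cst _) (fun _ _ => ler01)) H.
apply: le_lt_trans; last first.
  apply: le_lt_trans (H _) _; last exact: ltry.
  move=> j; under eq_integral do rewrite mulr1.
  rewrite mul1r integral_gauss ?dyadic_gt0// lee_fin /dyadic invrK natrX.
  rewrite sqrtrM ?pi_ge0// sqrtr_sqr ger0_norm ?exprn_ge0// mulrAC ler_piMl ?exprn_ge0//.
  rewrite ler_pdivrMr// mul1r -[leRHS](@ger0_norm _ 2)// -sqrtr_sqr ler_wsqrtr//.
  by rewrite (le_trans pi_le4)// expr2 -natrM.
under eq_integral => l _.
  rewrite /= ger0_norm; last by rewrite invr_ge0 ltW// weight_gt0.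
  rewrite -[(weight _ _)^-1]mulr1; over.
exact: lexx.
Qed.

Lemma euclidean_norm_axis s : euclidean_norm (s *: delta_mx 0 0 : 'rV[R]_3) = `|s|.
Proof.
rewrite /euclidean_norm (bigD1 ord0)//= big1 => [|i i0]; last first.
  by rewrite !mxE (negbTE i0) andbF mulr0 expr0n.
by rewrite !mxE eqxx/= mulr1 addr0 sqrtr_sqr.
Qed.

(** Along a coordinate axis the radial function reads [g |s|]; the empty list of directions in
    [smooth] makes it continuous. *)
Lemma smooth_radial_measurable (g : R -> R) :
  smooth (fun x : 'rV[R]_3 => g (euclidean_norm x)) -> measurable_fun D g.
Proof.
move=> /(_ [::]) /= [cg _].
have cgs : continuous (fun s : R => g `|s|).
  have -> : (fun s : R => g `|s|) =
      (fun x : 'rV[R]_3 => g (euclidean_norm x)) \o (fun s => s *: delta_mx 0 0).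
    by apply/funext => s /=; rewrite euclidean_norm_axis.
  move=> s; apply: continuous_comp; last exact: cg.
  by apply: continuousZr_tmp; exact: cvg_id.
apply: (@eq_measurable_fun _ _ _ _ _ (fun s => g `|s|)).
  by move=> s; rewrite inE => /in_halfline s0; rewrite ger0_norm// ltW.
apply: measurable_funTS; exact: continuous_measurable_fun.
Qed.

Lemma schwartz2_integrable f : schwartz2 f ->
  Int (fun s => complex.Re (f s) * sinh s) /\ Int (fun s => complex.Im (f s) * sinh s).
Proof.
move=> [[smr smi] decay].
(* The factor [e^s] of the Schwartz condition compensates [sinh s], and two powers of [1 + s] leave
   the integrable bound [B / (1 + s^2)]. *)
have [B hB] := decay 0%N 2%N.
have Bf s : 0 < s -> normc (f s) * sinh s <= B * (weight 1 s)^-1.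
  move=> s0; have := hB _ s0; rewrite /cderiven/= -/(normc (_ +i* _)).
  have -> : (complex.Re (f s) +i* complex.Im (f s)) = f s by case: (f s).
  move=> h; rewrite /weight powRr1 ?addr_ge0 ?sqr_ge0// ler_pdivlMr ?ltr_wpDl ?sqr_ge0//.
  apply: le_trans h.
  have n0 : 0 <= normc (f s) by case: (f s) => a b; exact: sqrtr_ge0.
  rewrite [leLHS](_ : _ = (s ^+ 2 + 1) * sinh s * normc (f s)); last by ring.
  rewrite ler_wpM2r// ler_pM ?(ltW (sinh_gt0 s0)) ?addr_ge0 ?sqr_ge0 ?sinh_le_expR//.
  by nra.
have iB : Int (fun s => B * (weight 1 s)^-1).
  by apply: integrable_halfZ; apply: integrable_inv_weight; lra.
have ms : measurable_fun D (@sinh R).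
  by apply: measurable_funTS; apply: continuous_measurable_fun; exact: continuous_sinh.
split; apply: (le_integrable_half _ _ iB).
- by apply: measurable_funM ms; exact: smooth_radial_measurable smr.
- move=> s s0; rewrite normrM [`|sinh s|]ger0_norm ?(ltW (sinh_gt0 s0))//.
  by rewrite (le_trans _ (Bf _ s0))// ler_wpM2r ?(ltW (sinh_gt0 s0))// normr_Re_le.
- by apply: measurable_funM ms; exact: smooth_radial_measurable smi.
- move=> s s0; rewrite normrM [`|sinh s|]ger0_norm ?(ltW (sinh_gt0 s0))//.
  by rewrite (le_trans _ (Bf _ s0))// ler_wpM2r ?(ltW (sinh_gt0 s0))// normr_Im_le.
Qed.

Lemma continuous_sine_transform (g : R -> R) : Int g ->
  continuous (fun l => I (fun s => g s * sin (l * s))).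
Proof.
move=> intg l0.
have := @continuity_under_integral _ _ _ mu (fun l s => g s * sin (l * s)) D mD
  (l0 - 1) (l0 + 1) _ _ (fun s => `|g s|) (@integrable_norm _ _ _ mu D _ intg) _ l0.
apply.
- move=> l _; under [X in EFin \o X]eq_fun do rewrite mulrC.
  by apply: integrable_half_bddM => [s|s|]; [exact: ex_derive|exact: normr_sin|exact: intg].
- apply: aeW => s _ l _; apply: differentiable_continuous; apply/derivable1_diffP.
  exact: ex_derive.
- by move=> l _; apply: aeW => s _; rewrite normrM ler_piMr ?normr_sin.
- by rewrite inE/= in_itv/= ltrBlDr !ltrDl ltr01.
Qed.

Lemma integrable_mul_sin (g : R -> R) l : Int g -> Int (fun s => g s * sin (l * s)).
Proof.
move=> intg; under [X in EFin \o X]eq_fun do rewrite mulrC.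
by apply: integrable_half_bddM => [s|s|]; [exact: ex_derive|exact: normr_sin|exact: intg].
Qed.

Lemma Rintegral_spherical (g : R -> R) l : 0 < l -> Int (fun s => g s * sinh s) ->
  l * I (fun s => g s * (spherical l s * sinh s ^+ 2)) =
  I (fun s => g s * sinh s * sin (l * s)).
Proof.
move=> l0 intg; rewrite -Rintegral_halfZ.
  apply: eq_Rintegral_half => s s0; rewrite /spherical; field.
  by rewrite !gt_eqF// sinh_gt0.
apply: (@eq_integrable _ _ _ mu D mD
    (EFin \o (fun s => l^-1 * (g s * sinh s * sin (l * s))))).
  move=> s; rewrite inE => /in_halfline s0 /=; congr EFin; rewrite /spherical; field.
  by rewrite !gt_eqF// sinh_gt0.
by apply: integrable_halfZ; exact: integrable_mul_sin.
Qed.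

Definition radial_re f l := l * complex.Re (spherical_transform f l).
Definition radial_im f l := l * complex.Im (spherical_transform f l).

Lemma radial_reE f l : 0 < l -> Int (fun s => complex.Re (f s) * sinh s) ->
  radial_re f l = I (fun s => complex.Re (f s) * sinh s * sin (l * s)).
Proof.
move=> l0 intf; rewrite -Rintegral_spherical// /radial_re; congr (_ * _).
rewrite /spherical_transform /cintegral/=; apply: eq_Rintegral_half => s _.
by case: (f s) => a b /=; rewrite mulr0 subr0.
Qed.

Lemma radial_imE f l : 0 < l -> Int (fun s => complex.Im (f s) * sinh s) ->
  radial_im f l = I (fun s => complex.Im (f s) * sinh s * sin (l * s)).
Proof.
move=> l0 intf; rewrite -Rintegral_spherical// /radial_im; congr (_ * _).
rewrite /spherical_transform /cintegral/=; apply: eq_Rintegral_half => s _.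
by case: (f s) => a b /=; rewrite mulr0 add0r.
Qed.

Lemma measurable_radial f : schwartz2 f ->
  measurable_fun D (radial_re f) /\ measurable_fun D (radial_im f).
Proof.
move=> /schwartz2_integrable[ir ii]; split.
- apply: (@eq_measurable_fun _ _ _ _ _
      (fun l => I (fun s => complex.Re (f s) * sinh s * sin (l * s)))).
    by move=> l; rewrite inE => /in_halfline l0; rewrite radial_reE.
  apply: measurable_funTS; apply: continuous_measurable_fun.
  exact: continuous_sine_transform ir.
- apply: (@eq_measurable_fun _ _ _ _ _
      (fun l => I (fun s => complex.Im (f s) * sinh s * sin (l * s)))).
    by move=> l; rewrite inE => /in_halfline l0; rewrite radial_imE.
  apply: measurable_funTS; apply: continuous_measurable_fun.
  exact: continuous_sine_transform ii.
Qed.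

Lemma sobolev_integrandE alpha f l :
  ((l ^+ 2 + 1) `^ alpha) * normc (spherical_transform f l) ^+ 2 * l ^+ 2 =
  weight alpha l * (radial_re f l ^+ 2 + radial_im f l ^+ 2).
Proof. by rewrite sqr_normc /radial_re /radial_im /weight; ring. Qed.

Lemma Re_schrodinger f t s : 0 < s -> Int (radial_re f) -> Int (radial_im f) ->
  complex.Re (schrodinger t f s) = (sinh s)^-1 * evol_re (radial_re f) (radial_im f) t s.
Proof.
move=> s0 ir ii; rewrite /evol_re -Rintegral_halfZ; last exact: integrable_evol_re.
rewrite /schrodinger /cintegral /radial_re /radial_im /spherical /expi.
move: (spherical_transform f) => F /=; apply: eq_Rintegral_half => l l0.
case: (F l) => a b /=.
by field; rewrite !gt_eqF// sinh_gt0.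
Qed.

Lemma Im_schrodinger f t s : 0 < s -> Int (radial_re f) -> Int (radial_im f) ->
  complex.Im (schrodinger t f s) = (sinh s)^-1 * evol_im (radial_re f) (radial_im f) t s.
Proof.
move=> s0 ir ii; rewrite /evol_im -Rintegral_halfZ; last exact: integrable_evol_im.
rewrite /schrodinger /cintegral /radial_re /radial_im /spherical /expi.
move: (spherical_transform f) => F /=; apply: eq_Rintegral_half => l l0.
case: (F l) => a b /=.
by field; rewrite !gt_eqF// sinh_gt0.
Qed.

Lemma sqr_normc_schrodinger f t s : 0 < s -> Int (radial_re f) -> Int (radial_im f) ->
  normc (schrodinger t f s) ^+ 2 * sinh s ^+ 2 =
  evol_re (radial_re f) (radial_im f) t s ^+ 2 + evol_im (radial_re f) (radial_im f) t s ^+ 2.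
Proof.
move=> s0 ir ii; rewrite sqr_normc Re_schrodinger// Im_schrodinger//.
by field; rewrite gt_eqF// sinh_gt0.
Qed.

(** Selects an almost optimal time; the inequality is strict because the supremum need not be
    attained. By contraposition, a bound [c] valid at all times bounds the supremum by
    [sqrt c / sinh s]. The time [1/2] witnesses that [c] and the supremum are nonnegative. *)
Lemma lt_maximal f s (c : R) : 0 < s ->
  (c%:E < maximal f s `^ 2 * (sinh s ^+ 2)%:E)%E ->
  exists2 t, 0 < t < 1 & c < normc (schrodinger t f s) ^+ 2 * sinh s ^+ 2.
Proof.
move=> s0 hc; apply: contrapT => h.
have sh := sinh_gt0 s0.
have hle t : 0 < t < 1 -> normc (schrodinger t f s) ^+ 2 * sinh s ^+ 2 <= c.
  by move=> t01; rewrite leNgt; apply/negP => hlt; apply: h; exists t.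
have n0 (z : R[i]) : 0 <= normc z by case: z => a b; exact: sqrtr_ge0.
have c0 : 0 <= c.
  apply: le_trans (hle 2^-1 _); first by rewrite mulr_ge0 ?sqr_ge0.
  by rewrite invr_gt0 ltr0n invf_lt1 ?ltr1n.
suff : (maximal f s `^ 2 * (sinh s ^+ 2)%:E <= c%:E)%E by rewrite leNgt hc.
have : (maximal f s <= (Num.sqrt c / sinh s)%:E)%E.
  apply: ge_ereal_sup => _ [t t01' <-]; rewrite lee_fin.
  have t01 : 0 < t < 1 by move: t01'; rewrite /= in_itv.
  rewrite ler_pdivlMr// -[leLHS]ger0_norm ?(mulr_ge0 (n0 _) (ltW sh))//.
  by rewrite -sqrtr_sqr ler_wsqrtr// exprMn hle.
have m0 : (0 <= maximal f s)%E.
  apply: (@le_trans _ _ (normc (schrodinger 2^-1 f s))%:E); first by rewrite lee_fin n0.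
  apply: ereal_sup_ubound; exists 2^-1 => //=.
  by rewrite in_itv/= invr_gt0 ltr0n invf_lt1 ?ltr1n.
case: (maximal f s) m0 => [m| |] // m0 hm.
move: m0 hm; rewrite !lee_fin => m0 hm.
rewrite powR_mulrn// -exprMn.
rewrite -[leRHS]sqr_sqrtr// ler_sqr ?nnegrE ?sqrtr_ge0 ?(mulr_ge0 m0 (ltW sh))//.
by rewrite -ler_pdivlMr.
Qed.

End schwartz_functions.

(** * The maximal estimate for [q = 2] *)

Section global_estimate.
Context {R : realType}.

Local Notation mu := (@lebesgue_measure R).
Local Notation D := (@halfline R).
Local Notation Int f := (mu.-integrable D (EFin \o f)).
Local Notation I f := (Rintegral mu D f).
Local Notation mD := measurable_halfline.

(** Since [|g| <= 1 / w + w g^2] for the weight [w], a finite Sobolev norm makes the integral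
    defining the evolution absolutely convergent. *)
Lemma integrable_of_weighted alpha (g h : R -> R) : 2^-1 < alpha ->
  measurable_fun D g -> (forall l, g l ^+ 2 <= h l) ->
  Int (fun l => weight alpha l * h l) -> Int g.
Proof.
move=> a1 mg gh inth.
apply: (@le_integrable_half _ _ (fun l => (weight alpha l)^-1 + weight alpha l * h l)) => //.
  move=> l l0; have w0 := weight_gt0 alpha l.
  apply: (@le_trans _ _ ((weight alpha l)^-1 + weight alpha l * g l ^+ 2)); last first.
    by rewrite lerD2l ler_wpM2l// ltW.
  rewrite -(real_normK (num_real (g l))); move: (`|g l|) (normr_ge0 (g l)) => y y0.
  rewrite -(ler_pM2l w0) mulrDr divff ?gt_eqF//.
  by have := sqr_ge0 (weight alpha l * y - 1); nra.
by apply: integrable_halfD => //; exact: integrable_inv_weight.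
Qed.

Lemma integral_maximal_le alpha : 2^-1 < alpha -> forall f : R -> R[i],
  Int (radial_re f) -> Int (radial_im f) ->
  Int (fun l => weight alpha l * (radial_re f l ^+ 2 + radial_im f l ^+ 2)) ->
  (\int[mu]_(s in D) (maximal f s `^ 2 * (sinh s ^+ 2)%:E) <=
   (80 * (expR 4 / (1 - 2 / 4 `^ alpha)) *
    I (fun l => weight alpha l * (radial_re f l ^+ 2 + radial_im f l ^+ 2)))%:E)%E.
Proof.
move=> a1 f ir ii inth; set N := I _; set K := 80 * _.
apply: integral_le_lattice.
  by move=> s _; rewrite mule_ge0 ?poweR_ge0// lee_fin sqr_ge0.
move=> th n h th0 hh.
apply/ler_addgt0Pr => e e0.
(* The choice of an almost optimal time costs [e / (n + 1)] in each of the [n] cells, at most [e] in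
   total; [n.+1] also covers [n = 0]. *)
have en0 : 0 < e / n.+1%:R by rewrite divr_gt0.
have x0 k : 0 < th + k%:R by rewrite ltr_wpDr.
have /choice[t ht] : forall k, exists t, 0 < t < 1 /\
    h k - e / n.+1%:R < normc (schrodinger t f (th + k%:R)) ^+ 2 * sinh (th + k%:R) ^+ 2.
  move=> k; have [|t t01 ht] := @lt_maximal _ f _ (h k - e / n.+1%:R) (x0 k).
    by apply: lt_le_trans (hh k); rewrite lte_fin ltrBlDr ltrDl.
  by exists t.
have dist j k : ((j - k) + (k - j))%N%:R <= `|(th + j%:R) - (th + k%:R)| :> R.
  rewrite (_ : _ - _ = j%:R - k%:R); last by ring.
  case: (leqP j k) => jk.
    rewrite (_ : (j - k + (k - j))%N = (k - j)%N); last by lia.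
    by rewrite natrB// ler_normr opprB lexx orbT.
  rewrite (_ : (j - k + (k - j))%N = (j - k)%N); last by lia.
  by rewrite natrB ?(ltnW jk)// ler_norm.
have sum j k : ((j - k) + (k - j))%N%:R <= `|(th + j%:R) + (th + k%:R)| :> R.
  rewrite ger0_norm ?(addr_ge0 (ltW (x0 _)) (ltW (x0 _)))//.
  apply: (@le_trans _ _ (j + k)%N%:R); first by rewrite ler_nat; lia.
  by rewrite natrD; lra.
have := @sum_sqr_evol_le R n (fun k => th + k%:R) t
  (fun k => evol_re (radial_re f) (radial_im f) (t k) (th + k%:R))
  (fun k => evol_im (radial_re f) (radial_im f) (t k) (th + k%:R))
  (fun k => proj1 (ht k)) dist sum alpha (radial_re f) (radial_im f) a1 ir ii inth
  (fun=> erefl) (fun=> erefl).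
rewrite -/K -/N => hsum.
apply: (@le_trans _ _ (\sum_(k < n) (evol_re (radial_re f) (radial_im f) (t k) (th + k%:R) ^+ 2 +
    evol_im (radial_re f) (radial_im f) (t k) (th + k%:R) ^+ 2 + e / n.+1%:R))).
  apply: ler_sum => k _; have [_] := ht k.
  by rewrite sqr_normc_schrodinger// ltrBlDr => /ltW.
rewrite big_split/= lerD// sumr_const card_ord -[X in X <= _]mulr_natr.
rewrite -mulrA ler_piMr ?(ltW e0)// mulrC ler_pdivrMr// mul1r ler_nat//.
Qed.

Lemma maximal_estimate_2 alpha : 2^-1 < alpha -> maximal_estimate (R := R) alpha 2.
Proof.
move=> a1; set K : R := 80 * (expR 4 / (1 - 2 / 4 `^ alpha)).
have K0 : 0 < K.
  rewrite mulr_gt0// divr_gt0 ?expR_gt0// subr_gt0 ltr_pdivrMr ?powR_gt0// mul1r.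
  exact: lt_2_powR4.
exists (Num.sqrt K) => f sf.
rewrite /Lq_norm /sobolev_norm.
under [in leRHS]eq_integral do rewrite sobolev_integrandE.
set h : R -> R := fun l => weight alpha l * (radial_re f l ^+ 2 + radial_im f l ^+ 2).
have [mr mi] := measurable_radial sf.
have mh : measurable_fun D h.
  apply: measurable_funM; first exact: measurable_weight.
  by apply: measurable_funD; exact: measurable_funX.
have h0 l : 0 <= h l by rewrite mulr_ge0 ?addr_ge0 ?sqr_ge0 ?(ltW (weight_gt0 _ _)).
have N0 : (0 <= \int[mu]_(l in D) (h l)%:E)%E by apply: integral_ge0 => l _; rewrite lee_fin.
(* Finiteness of the Sobolev norm is not derived from the Schwartz condition: if the norm is
   infinite, the right-hand side is [+oo] because the constant is positive. *)
have [Noo|Nfin] := eqVneq (\int[mu]_(l in D) (h l)%:E)%E +oo%E.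
  rewrite Noo poweRyr ?invr_neq0// gt0_muley ?leey// lte_fin sqrtr_gt0//.
have inth : Int h.
  apply/integrableP; split; first exact/measurable_EFinP.
  under eq_integral do rewrite /= ger0_norm//.
  by rewrite ltey.
have ir : Int (radial_re f).
  by apply: (integrable_of_weighted a1 mr _ inth) => l; rewrite lerDl sqr_ge0.
have ii : Int (radial_im f).
  by apply: (integrable_of_weighted a1 mi _ inth) => l; rewrite lerDr sqr_ge0.
have main := integral_maximal_le a1 ir ii inth.
rewrite integral_half_EFin// poweR_EFin -EFinM.
have I0 : 0 <= I h by apply: Rintegral_ge0 => l _; exact: h0.
apply: (@le_trans _ _ ((K * I h)%:E `^ 2^-1)%E).
  apply: gt0_ler_poweR main; rewrite ?invr_ge0// in_itv/= leey andbT.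
    by apply: integral_ge0 => s _; rewrite mule_ge0 ?poweR_ge0// lee_fin sqr_ge0.
  by rewrite lee_fin mulr_ge0// ltW.
by rewrite poweR_EFin lee_fin powRM ?(ltW K0)// [in X in X <= _]powR12_sqrt// ltW.
Qed.

End global_estimate.

(** * The sine transform of [e^(- e s^2) sinh s] *)

Section gauss_sinh_transform.
Context {R : realType}.
Implicit Types (l s : R) (p h v : R -> R).

Local Notation mu := (@lebesgue_measure R).
Local Notation D := (@halfline R).
Local Notation Int f := (mu.-integrable D (EFin \o f)).
Local Notation I f := (Rintegral mu D f).

Definition cosh s : R := (expR s + expR (- s)) / 2.

Global Instance is_derive_sinh s : is_derive s (1 : R) (@sinh R) (cosh s).
Proof. by rewrite /sinh /cosh; apply: is_derive_eq; rewrite /GRing.scale/=; lra. Qed.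

Global Instance is_derive_cosh s : is_derive s (1 : R) cosh (sinh s).
Proof. by rewrite /sinh /cosh; apply: is_derive_eq; rewrite /GRing.scale/=; lra. Qed.

Lemma normr_sinh s : 0 < s -> `|sinh s| <= expR s.
Proof. by move=> s0; rewrite ger0_norm ?sinh_le_expR// ltW// sinh_gt0. Qed.

Lemma normr_cosh s : 0 < s -> `|cosh s| <= expR s.
Proof.
move=> s0; rewrite ger0_norm; last by rewrite divr_ge0// addr_ge0 ?expR_ge0.
rewrite ler_pdivrMr//; have : expR (- s) <= expR s by rewrite ler_expR; lra.
by lra.
Qed.

Section fixed_e.
Variable e : R.
Hypothesis e0 : 0 < e.

(** Completing the square: half of the Gaussian absorbs [e^s], since [s - e s^2 / 2] has maximum
    [1 / (2 e)]. *)
Lemma gauss_expR_le s : gauss e s * expR s <= expR (1 / (2 * e)) * gauss (e / 2) s.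
Proof.
rewrite /gauss -!expRD ler_expR -subr_ge0.
rewrite (_ : _ - _ = (e * s - 1) ^+ 2 / (2 * e)); last by field; rewrite gt_eqF.
by rewrite divr_ge0 ?sqr_ge0// mulr_ge0// ltW.
Qed.

Lemma gauss_exp_trig_le s (p h v : R) : `|p| <= 1 + s ^+ 2 -> `|h| <= expR s -> `|v| <= 1 ->
  `|p * (gauss e s * (h * v))| <= expR (1 / (2 * e)) * ((1 + s ^+ 2) * gauss (e / 2) s).
Proof.
move=> hp hh hv; have h1 := gauss_expR_le s.
rewrite !normrM (ger0_norm (gauss_ge0 _ _)) [leRHS]mulrCA.
rewrite ler_pM ?mulr_ge0 ?gauss_ge0//.
apply: le_trans h1; rewrite ler_wpM2l ?gauss_ge0// -[leRHS]mulr1.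
by rewrite ler_pM.
Qed.

Let dom s := expR (1 / (2 * e)) * ((1 + s ^+ 2) * gauss (e / 2) s).

Let e2 : 0 < e / 2. Proof. by rewrite divr_gt0. Qed.

Let dom0 s : 0 <= dom s.
Proof. by rewrite mulr_ge0 ?expR_ge0// mulr_ge0 ?gauss_ge0// addr_ge0 ?sqr_ge0. Qed.

Let integrable_dom : Int dom.
Proof. by apply: integrable_halfZ; exact: integrable_gauss2. Qed.

Lemma integrable_gauss_exp_trig p h v :
  (forall s, 0 < s -> `|p s| <= 1 + s ^+ 2) ->
  (forall s, 0 < s -> `|h s| <= expR s) -> (forall s, `|v s| <= 1) ->
  (forall s, derivable p s 1) -> (forall s, derivable h s 1) ->
  (forall s, derivable v s 1) -> Int (fun s => p s * (gauss e s * (h s * v s))).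
Proof.
move=> hp hh hv dp dh dv.
apply: (@le_integrable_half _ _ dom).
- apply: derivable_measurable => s.
  apply: derivableM; first exact: dp.
  by apply: derivableM; [exact: ex_derive|apply: derivableM; [exact: dh|exact: dv]].
- by move=> s s0; apply: gauss_exp_trig_le => //; [exact: hp|exact: hh].
- exact: integrable_dom.
Qed.

Lemma gauss_exp_trig_cvg0 p h v :
  (forall s, 0 < s -> `|p s| <= 1 + s ^+ 2) ->
  (forall s, 0 < s -> `|h s| <= expR s) -> (forall s, `|v s| <= 1) ->
  p n%:R * (gauss e n%:R * (h n%:R * v n%:R)) @[n --> \oo] --> 0.
Proof.
move=> hp hh hv; rewrite -cvg_shiftS; apply/norm_cvg0P.
apply: (@squeeze_cvgr _ _ _ _ (cst 0) (fun n => dom n.+1%:R)).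
- near=> n; rewrite normr_ge0/=.
  by apply: gauss_exp_trig_le; [exact: hp|exact: hh|exact: hv].
- exact: cvg_cst.
- rewrite (cvg_shiftS (fun n => dom n%:R)).
  suff H : (fun n => dom n%:R) @ \oo --> expR (1 / (2 * e)) * 0 by rewrite mulr0 in H.
  apply: cvgMr.
  have := @gauss_trig_cvg0 R (e / 2) (fun s => 1 + s ^+ 2) (fun=> 1) (fun=> 1) e2.
  under eq_fun do rewrite !mulr1.
  apply.
  + by move=> s s0; rewrite ger0_norm// addr_ge0 ?sqr_ge0.
  + by move=> s; rewrite normr1.
  + by move=> s; rewrite normr1.
Unshelve. all: by end_near. Qed.

(** The first letter records the hyperbolic factor, the second the trigonometric one. The transforms
    [ss] and [cc] are coupled: their derivatives in [l] involve [sc] and [cs], which integration by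
    parts in [s] returns to [ss] and [cc]. *)
Let ss l s := 1 * (gauss e s * (sinh s * sin (l * s))).
Let cc l s := 1 * (gauss e s * (cosh s * cos (l * s))).
Let sc l s := s * (gauss e s * (sinh s * cos (l * s))).
Let cs l s := s * (gauss e s * (cosh s * sin (l * s))).

Let integrable_ss l : Int (ss l).
Proof.
apply: (@integrable_gauss_exp_trig (fun=> 1)) => [s|s|s|s|s|s].
- exact: normr1_1D2.
- exact: normr_sinh.
- exact: normr_sin.
- exact: ex_derive.
- exact: ex_derive.
- exact: ex_derive.
Qed.

Let integrable_cc l : Int (cc l).
Proof.
apply: (@integrable_gauss_exp_trig (fun=> 1)) => [s|s|s|s|s|s].
- exact: normr1_1D2.
- exact: normr_cosh.
- exact: normr_cos.
- exact: ex_derive.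
- exact: ex_derive.
- exact: ex_derive.
Qed.

Let integrable_sc l : Int (sc l).
Proof.
apply: (@integrable_gauss_exp_trig id) => [s|s|s|s|s|s].
- exact: normr_id_1D2.
- exact: normr_sinh.
- exact: normr_cos.
- exact: ex_derive.
- exact: ex_derive.
- exact: ex_derive.
Qed.

Let integrable_cs l : Int (cs l).
Proof.
apply: (@integrable_gauss_exp_trig id) => [s|s|s|s|s|s].
- exact: normr_id_1D2.
- exact: normr_cosh.
- exact: normr_sin.
- exact: ex_derive.
- exact: ex_derive.
- exact: ex_derive.
Qed.

(** The boundary term at 0 vanishes through [sinh 0], and in [parts_cs] through [sin 0]. *)
Let parts_sc l : - (2 * e) * I (sc l) + I (cc l) - l * I (ss l) = 0.
Proof.
have i1 : Int (fun s => - (2 * e) * sc l s + cc l s).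
  by apply: integrable_halfD; [exact: integrable_halfZ|exact: integrable_cc].
have i2 : Int (fun s => l * ss l s) by exact: integrable_halfZ.
rewrite -!Rintegral_halfZ; [|exact: integrable_sc|exact: integrable_ss].
rewrite -Rintegral_halfD; [|exact: integrable_halfZ|exact: integrable_cc].
rewrite -Rintegral_halfB; [|exact: i1|exact: i2].
rewrite [LHS](@Rintegral_half_derivative R (fun s => 1 * (gauss e s * (sinh s * cos (l * s))))
  (fun s => - (2 * e) * sc l s + cc l s - l * ss l s)).
- by rewrite /sinh oppr0 subrr !mul0r !mulr0 oppr0.
- move=> s; rewrite /gauss; apply: is_derive_eq.
  by rewrite /sc /cc /ss /gauss /GRing.scale/=; ring.
- move=> s; apply: differentiable_continuous; apply/derivable1_diffP.
  by rewrite /sc /cc /ss /gauss; exact: ex_derive.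
- exact: integrable_halfB i1 i2.
- apply: (@gauss_exp_trig_cvg0 (fun=> 1) (@sinh R) (fun s => cos (l * s))) => [s|s|s].
  + exact: normr1_1D2.
  + exact: normr_sinh.
  + exact: normr_cos.
Qed.

Let parts_cs l : - (2 * e) * I (cs l) + I (ss l) + l * I (cc l) = 0.
Proof.
have i1 : Int (fun s => - (2 * e) * cs l s + ss l s).
  by apply: integrable_halfD; [exact: integrable_halfZ|exact: integrable_ss].
have i2 : Int (fun s => l * cc l s) by exact: integrable_halfZ.
rewrite -!Rintegral_halfZ; [|exact: integrable_cs|exact: integrable_cc].
rewrite -Rintegral_halfD; [|exact: integrable_halfZ|exact: integrable_ss].
rewrite -Rintegral_halfD; [|exact: i1|exact: i2].
rewrite [LHS](@Rintegral_half_derivative R (fun s => 1 * (gauss e s * (cosh s * sin (l * s))))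
  (fun s => - (2 * e) * cs l s + ss l s + l * cc l s)).
- by rewrite mulr0 sin0 !mulr0 oppr0.
- move=> s; rewrite /gauss; apply: is_derive_eq.
  by rewrite /cs /cc /ss /gauss /GRing.scale/=; ring.
- move=> s; apply: differentiable_continuous; apply/derivable1_diffP.
  by rewrite /cs /cc /ss /gauss; exact: ex_derive.
- exact: integrable_halfD i1 i2.
- apply: (@gauss_exp_trig_cvg0 (fun=> 1) cosh (fun s => sin (l * s))) => [s|s|s].
  + exact: normr1_1D2.
  + exact: normr_cosh.
  + exact: normr_sin.
Qed.

Let is_derive_ss l : is_derive l (1 : R) (fun l => I (ss l)) (I (sc l)).
Proof.
apply: (@is_derive_Rintegral_half _ ss sc dom).
- by move=> p s; rewrite /ss /sc; apply: is_derive_eq; rewrite /GRing.scale/=; ring.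
- exact: integrable_ss.
- exact: dom0.
- exact: integrable_dom.
- move=> p s s0; apply: gauss_exp_trig_le; [exact: normr_id_1D2|exact: normr_sinh|exact: normr_cos].
Qed.

Let is_derive_cc l : is_derive l (1 : R) (fun l => I (cc l)) (- I (cs l)).
Proof.
have -> : - I (cs l) = I (fun s => -1 * cs l s).
  by rewrite Rintegral_halfZ ?mulN1r//; exact: integrable_cs.
apply: (@is_derive_Rintegral_half _ cc (fun l s => -1 * cs l s) dom).
- by move=> p s; rewrite /cc /cs; apply: is_derive_eq; rewrite /GRing.scale/=; ring.
- exact: integrable_cc.
- exact: dom0.
- exact: integrable_dom.
- move=> p s s0; rewrite mulN1r normrN.
  by apply: gauss_exp_trig_le; [exact: normr_id_1D2|exact: normr_cosh|exact: normr_sin].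
Qed.

(** Its value is [sqrt (pi / e) e^(1/(4 e)) / 2]. It is left unevaluated, being a common positive
    factor of both sides of the estimate to be refuted. *)
Definition gauss_cosh_mass : R := I (fun s => gauss e s * cosh s).

(* [(I (cc l), I (ss l)) exp (l^2 / (4 e))] rotates at angular speed [1 / (2 e)]. *)
Lemma gauss_sinh_transform l :
  I (fun s => gauss e s * sinh s * sin (l * s)) =
  gauss_cosh_mass * gauss (4 * e)^-1 l * sin (l / (2 * e)).
Proof.
have -> : I (fun s => gauss e s * sinh s * sin (l * s)) = I (ss l).
  by apply: eq_Rintegral_half => s _; rewrite /ss; ring.
pose E l := expR (l ^+ 2 / (4 * e)).
pose U l := E l * (I (ss l) * cos (l / (2 * e)) - I (cc l) * sin (l / (2 * e))).
pose W l := E l * (I (ss l) * sin (l / (2 * e)) + I (cc l) * cos (l / (2 * e))).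
have en0 : e != 0 by rewrite gt_eqF.
have dE (y : R) : is_derive y (1 : R) E (E y * (y / (2 * e))).
  by rewrite /E; apply: is_derive_eq; rewrite /GRing.scale/=; field.
have SC y : I (sc y) = (I (cc y) - y * I (ss y)) / (2 * e).
  apply: (@mulIf _ (2 * e)); rewrite ?mulf_neq0// divfK ?mulf_neq0//.
  by have := parts_sc y; move: (I _) (I _) (I _) => a b c; lra.
have CS y : I (cs y) = (I (ss y) + y * I (cc y)) / (2 * e).
  apply: (@mulIf _ (2 * e)); rewrite ?mulf_neq0// divfK ?mulf_neq0//.
  by have := parts_cs y; move: (I _) (I _) (I _) => a b c; lra.
have UE : U l = U 0.
  apply: is_derive_0_is_cst => y.
  have dss := is_derive_ss y; have dcc := is_derive_cc y.
  rewrite /U; apply: is_derive_eq; rewrite SC CS /GRing.scale/=.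
  by field.
have WE : W l = W 0.
  apply: is_derive_0_is_cst => y.
  have dss := is_derive_ss y; have dcc := is_derive_cc y.
  rewrite /W; apply: is_derive_eq; rewrite SC CS /GRing.scale/=.
  by field.
have ss0 : I (ss 0) = 0.
  rewrite (@eq_Rintegral_half _ _ (fun=> 0)) ?Rintegral_cst ?mul0r//.
    exact: measurable_halfline.
  by move=> s _; rewrite /ss mul0r sin0 !mulr0.
have cc0 : I (cc 0) = gauss_cosh_mass.
  by apply: eq_Rintegral_half => s _; rewrite /cc mul0r cos0 !mulr1 mul1r.
have U0 : U 0 = 0 by rewrite /U ss0 !mul0r sin0 mulr0 subr0 mulr0.
have W0 : W 0 = gauss_cosh_mass.
  by rewrite /W ss0 cc0 !mul0r cos0 add0r mulr1 /E expr0n/= mul0r expR0 mul1r.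
have E0 : E l != 0 by rewrite gt_eqF// expR_gt0.
have -> : gauss (4 * e)^-1 l = (E l)^-1 by rewrite /gauss expRN mulrC.
rewrite -W0 -WE.
have h := cos2Dsin2 (l / (2 * e)).
transitivity ((E l)^-1 * (U l * cos (l / (2 * e)) + W l * sin (l / (2 * e)))); last first.
  by rewrite UE U0 mul0r add0r; ring.
rewrite /U /W.
transitivity ((E l)^-1 * E l * (I (ss l) * (cos (l / (2 * e)) ^+ 2 + sin (l / (2 * e)) ^+ 2))).
  by rewrite h mulr1 mulVf// mul1r.
by ring.
Qed.

Lemma gauss_cosh_mass_gt0 : 0 < gauss_cosh_mass.
Proof.
apply: (@lt_le_trans _ _ (I (gauss e))).
  by rewrite /gauss Rintegral_gauss// divr_gt0// sqrtr_gt0 divr_gt0// pi_gt0.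
apply: le_Rintegral_half.
- exact: integrable_gauss.
- have := integrable_cc 0; apply: (@eq_integrable _ _ _ mu D measurable_halfline) => s _.
  by rewrite /= /cc mul0r cos0 mulr1 mul1r.
- move=> s s0; rewrite ler_peMr ?gauss_ge0// /cosh ler_pdivlMr// mul1r.
  have := expR_gt0 s; rewrite expRN => h; rewrite -subr_ge0.
  rewrite (_ : _ - _ = (expR s - 1) ^+ 2 / expR s); last by field; rewrite gt_eqF.
  by rewrite divr_ge0 ?sqr_ge0// ltW.
Qed.

End fixed_e.
End gauss_sinh_transform.

(** * Gaussians belong to the radial Schwartz class *)

Section gaussian_schwartz.
Context {R : realType}.
Variable e : R.
Hypothesis e0 : 0 < e.

(** Reduces a directional derivative to a one-variable derivative at 0, which the [is_derive]
    instances compute. *)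
Lemma is_derive_along_line (V : normedModType R) (f : V -> R) (x v : V) (d : R) :
  is_derive (0 : R) (1 : R) (fun h : R => f (h *: v + x)) d -> is_derive x v f d.
Proof.
move=> [df dE]; apply: DeriveDef; first exact/derivable1P.
rewrite -dE /derive; congr (lim _); apply: congr2 => //; apply/funext => h.
by rewrite /= scale0r add0r addr0 [h%:A]mulr1.
Qed.

(* A class of smooth functions closed under directional derivatives. *)
Inductive gauss_polynomial : ('rV[R]_3 -> R) -> Prop :=
| gauss_polynomial_cst c : gauss_polynomial (fun=> c)
| gauss_polynomial_coord i : gauss_polynomial (fun x => x ord0 i)
| gauss_polynomial_gauss :
    gauss_polynomial (fun x => expR (- (e * (\sum_(i < 3) x ord0 i ^+ 2))))
| gauss_polynomial_add f g : gauss_polynomial f -> gauss_polynomial g ->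
    gauss_polynomial (fun x => f x + g x)
| gauss_polynomial_mul f g : gauss_polynomial f -> gauss_polynomial g ->
    gauss_polynomial (fun x => f x * g x).

Lemma gauss_polynomial_continuous f : gauss_polynomial f -> continuous f.
Proof.
elim=> [c|i| |g h _ cg _ ch|g h _ cg _ ch] x.
- exact: cst_continuous.
- exact: coord_continuous.
- have sq i : {for x, continuous (fun y : 'rV[R]_3 => y ord0 i ^+ 2)}.
    apply: (@continuous_comp _ _ _ (fun x : 'rV[R]_3 => x ord0 i) (fun y => y ^+ 2)).
      exact: coord_continuous.
    exact: exprn_continuous.
  apply: (@continuous_comp _ _ _ (fun x : 'rV[R]_3 => - (e * \sum_(i < 3) x ord0 i ^+ 2)) expR).
    apply: continuousN; apply: continuousM; first exact: cst_continuous.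
    rewrite (_ : (fun y : 'rV[R]_3 => _) = \sum_(i < 3) (fun y : 'rV[R]_3 => y ord0 i ^+ 2)).
      elim/big_ind: _ => [|g h cg ch|i _]; [exact: cst_continuous|exact: continuousD|exact: sq].
    by apply/funext => y; rewrite fct_sumE.
  exact: continuous_expR.
- by apply: continuousD; [exact: cg|exact: ch].
- by apply: continuousM; [exact: cg|exact: ch].
Qed.

Lemma gauss_polynomial_derive f : gauss_polynomial f -> forall v,
  exists2 f', gauss_polynomial f' & forall x, is_derive x v f (f' x).
Proof.
elim=> [c|i| |g h _ dg _ dh|g h Pg dg Ph dh] v.
- by exists (fun=> 0) => [|x]; [exact: gauss_polynomial_cst|exact: is_derive_cst].
- exists (fun=> v ord0 i) => [|x]; first exact: gauss_polynomial_cst.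
  apply: is_derive_along_line; under eq_fun do rewrite !mxE.
  by apply: is_derive_eq; rewrite /GRing.scale/=; ring.
- exists (fun x => expR (- (e * (\sum_(i < 3) x ord0 i ^+ 2))) *
    (- (2 * e) * (\sum_(i < 3) v ord0 i * x ord0 i))) => [|x].
    apply: gauss_polynomial_mul; first exact: gauss_polynomial_gauss.
    apply: gauss_polynomial_mul; first exact: gauss_polynomial_cst.
    have P i : gauss_polynomial (fun x => v ord0 i * x ord0 i).
      by apply: gauss_polynomial_mul; [exact: gauss_polynomial_cst|exact: gauss_polynomial_coord].
    under [fun x => \sum_(i < 3) _]eq_fun do rewrite !big_ord_recl big_ord0.
    by do 3 (apply: gauss_polynomial_add => //); exact: gauss_polynomial_cst.
  apply: is_derive_along_line.
  under eq_fun do rewrite !big_ord_recl big_ord0 !mxE.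
  by apply: is_derive_eq; rewrite !big_ord_recl !big_ord0 /GRing.scale/= !mul0r !add0r; ring.
- have [g' Pg' dg'] := dg v; have [h' Ph' dh'] := dh v.
  exists (fun x => g' x + h' x) => [|x]; first exact: gauss_polynomial_add.
  have := dg' x; have := dh' x => ? ?; exact: is_deriveD.
- have [g' Pg' dg'] := dg v; have [h' Ph' dh'] := dh v.
  exists (fun x => g x * h' x + h x * g' x) => [|x].
    by apply: gauss_polynomial_add; exact: gauss_polynomial_mul.
  have := dg' x; have := dh' x => ? ?; exact: is_deriveM.
Qed.

Lemma gauss_polynomial_smooth f : gauss_polynomial f -> smooth f.
Proof.
move=> Pf vs /=; have : gauss_polynomial (foldr (fun v (k : 'rV[R]_3 -> R) => 'D_v k) f vs).
  elim: vs => //= v vs; move: (foldr _ _ _) => g Pg.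
  have [g' Pg' dg'] := gauss_polynomial_derive Pg v.
  by rewrite (_ : 'D_v g = g')//; apply/funext => x; exact: derive_val.
move: (foldr _ _ _) => h Ph; split; first exact: gauss_polynomial_continuous.
by move=> x v; have [h' _ dh'] := gauss_polynomial_derive Ph v; exact: ex_derive.
Qed.

Definition gaussian (s : R) : R[i] := (gauss e s)%:C.

Lemma smooth_radial_gaussian : smooth_radial gaussian.
Proof.
split => /=.
- apply: gauss_polynomial_smooth.
  rewrite (_ : (fun x => _) = fun x : 'rV[R]_3 => expR (- (e * (\sum_(i < 3) x ord0 i ^+ 2)))).
    exact: gauss_polynomial_gauss.
  apply/funext => x; rewrite /gauss /euclidean_norm sqr_sqrtr//.
  by apply: sumr_ge0 => i _; exact: sqr_ge0.
- exact/gauss_polynomial_smooth/gauss_polynomial_cst.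
Qed.

Lemma derive1n_gauss M : exists p : {poly R},
  derive1n M (gauss e) = fun s => p.[s] * gauss e s.
Proof.
elim: M => [|M [p IH]].
  by exists 1; apply/funext => s; rewrite hornerE mul1r.
exists (p^`() - (2 * e) *: ('X * p)); apply/funext => s.
rewrite derive1nS IH derive1E.
have dp : is_derive s 1 (horner p) p^`().[s] by exact: is_derive_poly.
apply: derive_val; rewrite /gauss; apply: is_derive_eq.
by rewrite !hornerE /GRing.scale/=; ring.
Qed.

(** Induction in Horner form: a factor [s] costs one power of [1 + s], which is why [N] is general.
    For the constant term [(1 + s)^N e^s <= e^((N+1) s)], and completing the square in
    [(N+1) s - e s^2] gives the exponent [(N+1)^2 / (4 e)]. *)
Lemma poly_gauss_decay (p : {poly R}) N : exists B, forall s, 0 < s ->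
  (1 + s) ^+ N * expR s * `|p.[s] * gauss e s| <= B.
Proof.
elim/poly_ind: p N => [|p c IH] N.
  by exists 0 => s _; rewrite horner0 mul0r normr0 mulr0.
have [B hB] := IH N.+1.
exists (B + `|c| * expR ((N.+1%:R ^+ 2) / (4 * e))) => s s0.
have A0 : 0 <= (1 + s) ^+ N * expR s.
  by rewrite mulr_ge0 ?expR_ge0// exprn_ge0// addr_ge0// ltW.
rewrite hornerMXaddC mulrDl.
apply: (le_trans (ler_wpM2l A0 (ler_normD _ _))); rewrite mulrDr lerD//.
  apply: le_trans (hB _ s0).
  rewrite exprS !normrM [`|s|]ger0_norm ?(ltW s0)//.
  rewrite [leLHS](_ : _ = s * ((1 + s) ^+ N * expR s * (`|p.[s]| * `|gauss e s|))); last by ring.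
  rewrite [leRHS](_ : _ = (1 + s) * ((1 + s) ^+ N * expR s * (`|p.[s]| * `|gauss e s|))); last by ring.
  by rewrite ler_wpM2r ?lerDr// mulr_ge0// mulr_ge0.
rewrite normrM mulrCA ler_wpM2l// ger0_norm ?gauss_ge0//.
apply: (@le_trans _ _ (expR (N%:R * s) * expR s * gauss e s)).
  rewrite !ler_wpM2r ?gauss_ge0 ?expR_ge0//.
  by rewrite expRM_natl lerXn2r ?nnegrE ?expR_ge0 ?expR_ge1Dx ?(addr_ge0 ler01 (ltW s0)).
rewrite /gauss -!expRD ler_expR -subr_ge0 -natr1.
rewrite (_ : _ - _ = (2 * e * s - (N%:R + 1)) ^+ 2 / (4 * e)); last by field; rewrite gt_eqF.
by rewrite divr_ge0 ?sqr_ge0// mulr_ge0// ltW.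
Qed.

Lemma schwartz2_gaussian : schwartz2 gaussian.
Proof.
split; first exact: smooth_radial_gaussian.
move=> M N; have [p pE] := derive1n_gauss M.
have [B hB] := poly_gauss_decay p N; exists B => s s0.
have d0 : derive1n M (fun=> 0 : R) = fun=> 0.
  elim: M {pE} => [//|M IH]; rewrite derive1nS IH; apply/funext => y.
  exact: derive1_cst.
by rewrite /cderiven/= d0 pE expr0n addr0 sqrtr_sqr hB.
Qed.

End gaussian_schwartz.

(** * Failure of the estimate for [q < 2] *)

Section failure_below_2.
Import HBNNSimple.
Context {R : realType}.
Implicit Types (e l s t : R).

Local Notation mu := (@lebesgue_measure R).
Local Notation D := (@halfline R).
Local Notation Int f := (mu.-integrable D (EFin \o f)).
Local Notation I f := (Rintegral mu D f).
Local Notation mD := measurable_halfline.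

(** Every simple function below [f] is below [g]; in this form the comparison applies to the maximal
    function. *)
Lemma le_integral_half (f g : R -> \bar R) :
  (forall s, 0 < s -> (0 <= f s)%E) -> (forall s, 0 < s -> (f s <= g s)%E) ->
  (\int[mu]_(s in D) f s <= \int[mu]_(s in D) g s)%E.
Proof.
move=> f0 fg; rewrite !ge0_integralE.
- apply: ereal_sup_le => _ [h hf <-]; exists h => //= s.
  apply: (le_trans (hf s)); rewrite !patchE; case: ifPn => //.
  by rewrite inE => /in_halfline; exact: fg.
- by move=> s /in_halfline s0; exact: le_trans (f0 _ s0) (fg _ s0).
- by move=> s /in_halfline; exact: f0.
Qed.

(** The time 0 lies outside the open interval of times and is reached as a limit: by domination the
    evolution is continuous in [t]. *)
Lemma normr_evol0_le_maximal (f : R -> R[i]) s : 0 < s ->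
  Int (radial_re f) -> Int (radial_im f) ->
  ((`|I (fun l => sin (l * s) * radial_re f l)| / sinh s)%:E <= maximal f s)%E.
Proof.
move=> s0 ir ii; have sh := sinh_gt0 s0.
set v := I _.
have hle t : 0 < t < 1 ->
    ((`|evol_re (radial_re f) (radial_im f) t s| / sinh s)%:E <= maximal f s)%E.
  move=> t01; apply: (@le_trans _ _ (normc (schrodinger t f s))%:E); last first.
    by apply: ereal_sup_ubound; exists t => //=; rewrite in_itv.
  rewrite lee_fin; apply: le_trans (normr_Re_le _).
  by rewrite Re_schrodinger// normrM [`|_^-1|]ger0_norm ?invr_ge0 ?(ltW sh)// mulrC.
have half01 : 0 < (2^-1 : R) < 1 by rewrite invr_gt0 ltr0n invf_lt1 ?ltr1n.
case: (maximal f s) hle => [m| |] hle; [|exact: leey|by have := hle _ half01].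
rewrite lee_fin ler_pdivrMr//.
pose ev t := evol_re (radial_re f) (radial_im f) t s.
have ev0 : ev 0 = v.
  by apply: eq_Rintegral_half => l _; rewrite !mul0r cos0 sin0 mul1r mul0r subr0.
have cev : {for 0, continuous ev}.
  have := @continuity_under_integral _ _ _ mu (fun t l => sin (l * s) *
    (cos (t * (l ^+ 2 + 1)) * radial_re f l - sin (t * (l ^+ 2 + 1)) * radial_im f l)) D mD
    (-1) 1 _ _ (fun l => `|radial_re f l| + `|radial_im f l|) _ _ 0.
  apply.
  - by move=> t _; exact: integrable_evol_re.
  - apply: aeW => l _ t _; apply: differentiable_continuous; apply/derivable1_diffP.
    exact: ex_derive.
  - by apply: integrable_halfD; exact: (@integrable_norm _ _ _ mu).
  - move=> t _; apply: aeW => l _; rewrite normrM -[leRHS]mul1r ler_pM ?normr_sin//.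
    rewrite (le_trans (ler_normB _ _))// !normrM lerD// ler_piMl//.
      exact: normr_cos.
    exact: normr_sin.
  - by rewrite inE/= in_itv/= oppr_lt0 ltr01.
(* [n.+2] keeps every time strictly below 1. *)
have h1 : (fun n => `|ev (n.+2%:R^-1)|) @ \oo --> `|v|.
  rewrite -ev0; apply: cvg_norm.
  apply: (continuous_cvg _ cev).
  rewrite (cvg_shiftS (fun n => n.+1%:R^-1 : R)); exact: cvg_harmonic.
apply: (@ler_cvg_to _ _ _ _ _ (fun=> m * sinh s) _ _ h1 (cvg_cst _)).
apply: nearW => n; rewrite -ler_pdivrMr// -lee_fin; apply: hle.
by rewrite invr_gt0 ltr0n invf_lt1 ?ltr0n// ltr1n.
Qed.

Section gaussian_data.
Variable e : R.
Hypothesis e0 : 0 < e.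

Local Notation A := (gauss_cosh_mass e).
Local Notation f := (gaussian e).

Let mass0 : 0 < A. Proof. exact: gauss_cosh_mass_gt0. Qed.

Lemma radial_im_gaussian l : radial_im f l = 0.
Proof.
rewrite /radial_im /spherical_transform /cintegral/=.
rewrite (@eq_Rintegral_half _ _ (fun=> 0)) ?Rintegral_cst ?mul0r ?mulr0//.
  exact: mD.
by move=> s _; rewrite mulr0 mul0r addr0.
Qed.

Lemma radial_re_gaussian l : 0 < l ->
  radial_re f l = A * gauss (4 * e)^-1 l * sin (l / (2 * e)).
Proof.
move=> l0; rewrite radial_reE//=; first exact: gauss_sinh_transform.
by have [] := schwartz2_integrable (schwartz2_gaussian e0).
Qed.

Let r0 : 0 < (4 * e)^-1. Proof. by rewrite invr_gt0 mulr_gt0. Qed.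

Lemma integrable_radial_re_gaussian : Int (radial_re f).
Proof.
apply: (@eq_integrable _ _ _ mu D mD
    (EFin \o (fun l => A * (sin (l / (2 * e)) * gauss (4 * e)^-1 l)))).
  move=> l; rewrite inE => /in_halfline l0 /=; congr EFin.
  by rewrite radial_re_gaussian//; ring.
apply: integrable_halfZ; apply: integrable_half_bddM => [l|l|].
- exact: ex_derive.
- exact: normr_sin.
- exact: integrable_gauss.
Qed.

Lemma integrable_radial_im_gaussian : Int (radial_im f).
Proof.
rewrite (_ : radial_im f = fun=> 0); last by apply/funext => l; exact: radial_im_gaussian.
exact: (@integrable0 _ _ _ mu D).
Qed.

(** Fourier inversion by direct computation: the product of sines gives two Gaussians centred at [b]
    and [- b] with [b = 1 / (2 e)], and expanding [e (s - b)^2 = e s^2 - s + 1 / (4 e)] and its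
    mirror image restores [sinh s]. *)
Lemma gaussian_inversion s :
  I (fun l => sin (l * s) * radial_re f l) =
  A * Num.sqrt (pi * e) * expR (- (4 * e)^-1) * (gauss e s * sinh s).
Proof.
set r := (4 * e)^-1; set b := (2 * e)^-1.
have c0 y : Int (fun l => gauss r l * (cos (0 * l ^+ 2) * cos (l * y))).
  exact: integrable_c0.
transitivity (A / 2 * (gcos r 0 (s - b) - gcos r 0 (s + b))).
  rewrite /gcos -Rintegral_halfB; [|exact: c0|exact: c0].
  rewrite -Rintegral_halfZ; last by apply: integrable_halfB; exact: c0.
  apply: eq_Rintegral_half => l l0; rewrite radial_re_gaussian//.
  have -> : cos (l * (s - b)) = cos (l * s) * cos (l * b) + sin (l * s) * sin (l * b).
    by rewrite mulrBr cosB.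
  have -> : cos (l * (s + b)) = cos (l * s) * cos (l * b) - sin (l * s) * sin (l * b).
    by rewrite mulrDr cosD.
  by rewrite mul0r cos0 -/r -/b; field.
rewrite !gcos_0//.
have -> : Num.sqrt (pi / r) / 2 = Num.sqrt (pi * e).
  rewrite /r invrK (_ : pi * (4 * e) = 2 ^+ 2 * (pi * e)); last by ring.
  by rewrite sqrtrM ?sqr_ge0// sqrtr_sqr ger0_norm// mulrC mulrA mulVf ?mul1r.
have en0 : e != 0 by rewrite gt_eqF.
have -> : expR (- ((s - b) ^+ 2 / (4 * r))) = expR (- (4 * e)^-1) * gauss e s * expR s.
  by rewrite /gauss -!expRD; congr expR; rewrite /r /b; field.
have -> : expR (- ((s + b) ^+ 2 / (4 * r))) = expR (- (4 * e)^-1) * gauss e s * expR (- s).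
  by rewrite /gauss -!expRD; congr expR; rewrite /r /b; field.
by rewrite /sinh -/r; field.
Qed.

Lemma maximal_gaussian_ge s : 0 < s ->
  ((A * Num.sqrt (pi * e) * expR (- (4 * e)^-1) * gauss e s)%:E <= maximal f s)%E.
Proof.
move=> s0; have := normr_evol0_le_maximal s0 integrable_radial_re_gaussian
  integrable_radial_im_gaussian.
rewrite gaussian_inversion ger0_norm.
  have sh := sinh_gt0 s0; move: (sinh s) sh => y y0.
  move: (A * _ * _) (gauss e s) => c g.
  by rewrite mulrA mulfK ?gt_eqF.
apply: mulr_ge0; last by apply: mulr_ge0; [exact: gauss_ge0|exact/ltW/sinh_gt0].
by rewrite !mulr_ge0 ?expR_ge0 ?sqrtr_ge0 ?(ltW mass0).
Qed.

End gaussian_data.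

Lemma integrable_weight_gauss alpha : 0 < alpha -> 
  Int (fun l => weight alpha l * gauss (2^-1) l).
Proof.
(* [K >= 1] gives [l^2 + 1 <= K e^(l^2 / K)], and [alpha / K <= 1/4] ensures that the power [alpha]
   of this exponential costs at most half of the Gaussian decay. *)
move=> a0; set K := 4 * alpha + 1.
have K1 : 1 <= K by rewrite lerDr mulr_ge0// ltW.
have K0 : 0 < K by rewrite (lt_le_trans _ K1).
apply: (@le_integrable_half _ _ (fun l => K `^ alpha * gauss (4^-1) l)).
- apply: measurable_funM; [exact: measurable_weight|exact: measurable_gauss].
- move=> l l0; rewrite ger0_norm ?mulr_ge0 ?gauss_ge0 ?(ltW (weight_gt0 _ _))//.
  have h : l ^+ 2 + 1 <= K * expR (l ^+ 2 / K).
    apply: (@le_trans _ _ (K * (1 + l ^+ 2 / K))).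
      by rewrite mulrDr mulr1 mulrCA divff ?gt_eqF// mulr1 addrC lerD2r.
    by rewrite ler_pM2l// expR_ge1Dx.
  have h2 : weight alpha l <= K `^ alpha * expR (l ^+ 2 / 4).
    rewrite /weight (le_trans (ge0_ler_powR (ltW a0) _ _ h)) ?nnegrE ?addr_ge0 ?sqr_ge0//.
      by rewrite mulr_ge0 ?expR_ge0// ltW.
    rewrite powRM ?(ltW K0) ?expR_ge0// ler_pM2l ?powR_gt0//.
    rewrite -expRM ler_expR -subr_ge0.
    rewrite (_ : _ - _ = l ^+ 2 / (4 * K)); last by rewrite /K; field; rewrite gt_eqF.
    by rewrite divr_ge0 ?sqr_ge0// mulr_ge0// ltW.
  apply: (le_trans (ler_wpM2r (gauss_ge0 _ _) h2)).
  rewrite -mulrA ler_pM2l ?powR_gt0// /gauss -expRD ler_expR.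
  by have := sqr_ge0 l; lra.
- by apply: integrable_halfZ; apply: integrable_gauss; rewrite invr_gt0.
Qed.

Lemma sobolev_norm_gaussian_le alpha e : 0 < alpha -> 0 < e <= 1 ->
  (sobolev_norm alpha (gaussian e) <=
   (gauss_cosh_mass e *
      Num.sqrt (I (fun l => weight alpha l * gauss (2^-1) l)))%:E)%E.
Proof.
move=> a0 /andP[e0 e1]; rewrite /sobolev_norm.
under eq_integral do rewrite sobolev_integrandE.
set h : R -> R := fun l => weight alpha l * (radial_re (gaussian e) l ^+ 2 + radial_im (gaussian e) l ^+ 2).
have h0 l : 0 <= h l by rewrite mulr_ge0 ?addr_ge0 ?sqr_ge0 ?(ltW (weight_gt0 _ _)).
have intM := integrable_weight_gauss a0.
set M := I _; set A := gauss_cosh_mass e.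
have A0 : 0 < A by exact: gauss_cosh_mass_gt0.
have M0 : 0 <= M.
  by apply: Rintegral_ge0 => l _; rewrite mulr_ge0 ?gauss_ge0 ?(ltW (weight_gt0 _ _)).
apply: (@le_trans _ _ ((A ^+ 2 * M)%:E `^ 2^-1)%E); last first.
  rewrite poweR_EFin lee_fin powR12_sqrt ?(mulr_ge0 (sqr_ge0 _) M0)//.
  by rewrite sqrtrM ?sqr_ge0// sqrtr_sqr ger0_norm// ltW.
apply: gt0_ler_poweR; rewrite ?invr_ge0// ?in_itv/= ?leey ?andbT.
- by apply: integral_ge0 => l _; rewrite lee_fin h0.
- by rewrite lee_fin (mulr_ge0 (sqr_ge0 _) M0).
rewrite -Rintegral_halfZ// -integral_half_EFin; last exact: integrable_halfZ.
apply: le_integral_half => l l0; first by rewrite lee_fin h0.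
rewrite lee_fin /h radial_im_gaussian// radial_re_gaussian//.
rewrite [0 ^+ 2]expr0n/= addr0 -/A.
set g := gauss _ l; set sn := sin _.
have -> : weight alpha l * (A * g * sn) ^+ 2 = A ^+ 2 * (weight alpha l * (g ^+ 2 * sn ^+ 2)) by ring.
rewrite ler_wpM2l ?sqr_ge0// ler_wpM2l ?(ltW (weight_gt0 _ _))// -[leRHS]mulr1.
rewrite ler_pM ?sqr_ge0//.
  (* [g^2 = e^(- l^2 / (2 e))] is at most [e^(- l^2 / 2)] since [e <= 1]; the bound is thus uniform
     in [e] up to the mass. *)
  rewrite /g /gauss -expRM_natl ler_expR mulrN lerN2.
  rewrite (_ : 2 * _ = e^-1 * (2^-1 * l ^+ 2)); last by field; rewrite gt_eqF.
  apply: ler_peMl; last by rewrite invf_ge1.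
  by apply: mulr_ge0; [rewrite invr_ge0|exact: sqr_ge0].
by rewrite -real_normK ?num_real// exprn_ile1// normr_sin.
Qed.

Lemma sinh_ge s : 2^-1 <= s -> expR s / 4 <= sinh s.
Proof.
move=> s1; rewrite /sinh; have h := expR_ge1Dx (2 * s).
have : expR (- s) * 2 <= expR s.
  rewrite expRN mulrC ler_pdivrMr ?expR_gt0// -expRD.
  by rewrite (_ : s + s = 2 * s); [lra|ring].
lra.
Qed.

(* [gauss e s ^ q * sinh s ^ 2] peaks near [s = b], of size [expR b]. *)
Lemma Lq_norm_ge (q e c : R) (g : R -> \bar R) : 1 <= q -> q < 2 -> 0 < e <= 1 ->
  0 <= c -> (forall s, 0 < s -> ((c * gauss e s)%:E <= g s)%E) ->
  ((c * (expR (- 2) / 16) * expR ((q ^+ 2 * e)^-1))%:E <= Lq_norm q g)%E.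
Proof.
move=> q1 q2 /andP[e0 e1] c0 hg.
have q0 : 0 < q by rewrite (lt_le_trans _ q1).
(* [e^-2] bounds the loss on the window [[b, b + 1]], where [q e (s - b)^2 <= 2]; the 16 comes from
   squaring [sinh s >= e^s / 4]. *)
set k := expR (- 2) / 16.
have k0 : 0 < k by rewrite divr_gt0 ?expR_gt0.
have k1 : k <= 1.
  by rewrite ler_pdivrMr// mul1r (@le_trans _ _ 1)// ?ler1n// -[leRHS]expR0 ler_expR; lra.
set b := (q * e)^-1.
have b0 : 0 < b by rewrite invr_gt0 mulr_gt0.
have b1 : 2^-1 <= b by rewrite lef_pV2 ?posrE ?mulr_gt0//; nra.
set X := c `^ q * (expR b * k).
have X0 : 0 <= X by rewrite mulr_ge0 ?powR_ge0// mulr_ge0 ?expR_ge0// ltW.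
have qn0 : q != 0 by rewrite gt_eqF.
have en0 : e != 0 by rewrite gt_eqF.
have gs0 s : 0 < s -> (0 <= g s)%E.
  by move=> s0; apply: le_trans (hg s s0); rewrite lee_fin mulr_ge0 ?gauss_ge0.
have low : (X%:E <= \int[mu]_(s in D) (g s `^ q * (sinh s ^+ 2)%:E))%E.
  have -> : X%:E = (\int[mu]_(s in D) (X * \1_(`[b, b + 1]%classic : set R) s)%:E)%E.
    under eq_integral do rewrite EFinM.
    rewrite ge0_integralZl_EFin//.
    - rewrite integral_indic//; last exact: mD.
      rewrite (_ : _ `&` _ = `[b, b + 1]%classic); last first.
        apply: setIidl => s /=; rewrite in_itv/= => /andP[bs _].
        exact/in_halfline/(lt_le_trans b0).
      rewrite [X in (_ * X)%E](_ : _ = 1%E) ?mule1//.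
      rewrite [LHS](@lebesgue_measure_itv R `[b, b + 1])/= lte_fin ltrDl ltr01 -EFinB.
      by congr EFin; ring.
    - exact: mD.
    - exact/measurable_EFinP.
  apply: le_integral_half => s s0.
    by rewrite lee_fin mulr_ge0.
  rewrite indicE; case: (boolP (s \in _)) => sb; last first.
    by rewrite mulr0 mule_ge0 ?poweR_ge0// lee_fin sqr_ge0.
  move: sb; rewrite inE/= in_itv/= => /andP[bs sb]; rewrite mulr1.
  apply: (@le_trans _ _ (((c * gauss e s)%:E `^ q) * (sinh s ^+ 2)%:E)%E); last first.
    rewrite lee_wpmul2r ?lee_fin ?sqr_ge0//.
    apply: gt0_ler_poweR (hg s s0); rewrite ?(ltW q0)// in_itv/= leey andbT ?gs0//.
    by rewrite lee_fin mulr_ge0 ?gauss_ge0.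
  rewrite poweR_EFin -EFinM lee_fin powRM ?gauss_ge0// /X -mulrA ler_wpM2l ?powR_ge0//.
  have sh : (expR s / 4) ^+ 2 <= sinh s ^+ 2.
    rewrite lerXn2r ?nnegrE ?(ltW (sinh_gt0 s0)) ?(divr_ge0 (expR_ge0 _))//.
    by rewrite sinh_ge// (le_trans b1).
  apply: le_trans (ler_wpM2l (powR_ge0 _ _) sh).
  rewrite /gauss -expRM expr_div_n -expRM_natl /k.
  rewrite (_ : 4 ^+ 2 = 16 :> R); last by rewrite -natrX.
  rewrite !mulrA ler_pM2r ?invr_gt0// -!expRD ler_expR -subr_ge0.
  rewrite (_ : _ - _ = 2 - q * e * (s - b) ^+ 2); last by rewrite /b; field; rewrite qn0 en0.
  rewrite subr_ge0 (@le_trans _ _ (2 * 1))//; last by rewrite mulr1.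
  have u0 : 0 <= s - b by rewrite subr_ge0.
  have u1 : s - b <= 1 by rewrite lerBlDl.
  have qe : q * e <= 2 by nra.
  by apply: ler_pM => //; [rewrite mulr_ge0 ?(ltW q0) ?(ltW e0)|exact: sqr_ge0|exact: exprn_ile1].
rewrite /Lq_norm; apply: (@le_trans _ _ (X%:E `^ q^-1)%E); last first.
  apply: gt0_ler_poweR low; rewrite ?invr_ge0 ?(ltW q0)// in_itv/= leey andbT//.
  apply: integral_ge0 => s /in_halfline s0.
  by rewrite mule_ge0 ?poweR_ge0// lee_fin sqr_ge0.
rewrite poweR_EFin lee_fin /X powRM ?powR_ge0 ?mulr_ge0 ?expR_ge0 ?(ltW k0)//.
rewrite -powRrM divff// powRr1// -mulrA ler_wpM2l//.
rewrite powRM ?expR_ge0 ?(ltW k0)// -expRM mulrC.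
rewrite (_ : b * q^-1 = (q ^+ 2 * e)^-1); last by rewrite /b; field; rewrite qn0 en0.
rewrite ler_wpM2l ?expR_ge0//.
(* Since [k <= 1], the root of order [q] can only increase it, so the final constant is free of
   [q]. *)
have : k `^ 1 <= k `^ q^-1.
  by apply: ger_powR; rewrite ?k0// invf_le1.
by rewrite powRr1// ltW.
Qed.

Lemma not_maximal_estimate_lt2 (alpha q : R) : 2^-1 < alpha -> 1 <= q -> q < 2 ->
  ~ maximal_estimate (R := R) alpha q.
Proof.
move=> a1 q1 q2 [C hC].
have a0 : 0 < alpha by rewrite (lt_trans _ a1).
have q0 : 0 < q by rewrite (lt_le_trans _ q1).
set M := I (fun l => weight alpha l * gauss (2^-1) l).
set k : R := expR (- 2) / 16.
have k0 : 0 < k by rewrite divr_gt0 ?expR_gt0.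
set d := (q ^+ 2)^-1 - 4^-1.
have d0 : 0 < d.
  by rewrite subr_gt0 ltf_pV2 ?posrE ?exprn_gt0//; nra.
have key e : 0 < e <= 1 ->
    Num.sqrt (pi * e) * k * expR (d / e) <= `|C| * Num.sqrt M.
  move=> e01; have /andP[e0 e1] := e01.
  have A0 := gauss_cosh_mass_gt0 e0; set A := gauss_cosh_mass e in A0.
  pose c := A * Num.sqrt (pi * e) * expR (- (4 * e)^-1).
  have c0 : 0 <= c by rewrite mulr_ge0 ?expR_ge0// mulr_ge0 ?sqrtr_ge0// ltW.
  have low := Lq_norm_ge q1 q2 e01 c0 (maximal_gaussian_ge e0).
  have up := hC _ (schwartz2_gaussian e0).
  have sob := sobolev_norm_gaussian_le a0 e01.
  have sob0 : (0 <= sobolev_norm alpha (gaussian e))%E by exact: poweR_ge0.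
  (* The sign of [C] is unknown; its absolute value is needed before the Sobolev bound can be
     multiplied in. *)
  have : (C%:E * sobolev_norm alpha (gaussian e) <=
      `|C|%:E * (A * Num.sqrt M)%:E)%E.
    apply: (@le_trans _ _ (`|C|%:E * sobolev_norm alpha (gaussian e))%E).
      by rewrite lee_wpmul2r// lee_fin ler_norm.
    by rewrite lee_wpmul2l// lee_fin.
  move=> /(le_trans up) /(le_trans low); rewrite -EFinM lee_fin /c => h.
  rewrite -(ler_pM2l A0); apply: le_trans (le_trans h _); last by rewrite mulrCA.
  rewrite -/k [leRHS](_ : _ = A * (Num.sqrt (pi * e) * k *
     (expR (- (4 * e)^-1) * expR ((q ^+ 2 * e)^-1)))); last by ring.
  rewrite -expRD (_ : _ + _ = d / e)//.
  by rewrite /d; field; rewrite !gt_eqF.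
have sq n : n.+1%:R^-1 <= Num.sqrt (pi * n.+1%:R^-1) :> R.
  rewrite -[leLHS](@ger0_norm _ n.+1%:R^-1)// -sqrtr_sqr ler_wsqrtr// expr2.
  rewrite ler_wpM2r// (@le_trans _ _ 1)//; first by rewrite invf_le1// ler1n.
  by rewrite (le_trans _ (pi_ge2 R))// ler1n.
set B := `|C| * Num.sqrt M.
(* With [e = 1 / (n + 1)], the bounds [sqrt (pi e) >= e] and [e^(2 y) >= y^2] at [y = d (n + 1) / 2]
   make the left-hand side of [key] at least linear in [n + 1], which no constant can dominate. *)
have bound n : k * (d ^+ 2 / 4) * n.+1%:R <= B.
  have n0 : 0 < n.+1%:R :> R by rewrite ltr0n.
  have := key n.+1%:R^-1; rewrite invr_gt0 n0 invf_le1// ler1n => /(_ isT).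
  apply: le_trans; rewrite invrK.
  have he : (d * n.+1%:R / 2) ^+ 2 <= expR (d * n.+1%:R).
    rewrite [X in expR X](_ : _ = 2%:R * (d * n.+1%:R / 2)); last by field.
    rewrite expRM_natl lerXn2r ?nnegrE ?expR_ge0 ?divr_ge0 ?mulr_ge0 ?(ltW d0)//.
    by apply: le_trans (expR_ge1Dx _); rewrite lerDr.
  apply: (@le_trans _ _ (n.+1%:R^-1 * k * (d * n.+1%:R / 2) ^+ 2)).
    rewrite le_eqVlt; apply/orP; left; apply/eqP; field.
    by rewrite gt_eqF.
  apply: ler_pM => //; [by rewrite mulr_ge0 ?invr_ge0 ?(ltW k0)|exact: sqr_ge0|].
  by rewrite ler_wpM2r// ltW.
have z0 : 0 < k * (d ^+ 2 / 4) by rewrite mulr_gt0// divr_gt0// exprn_gt0.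
have B0 : 0 <= B / (k * (d ^+ 2 / 4)).
  by rewrite divr_ge0 ?(ltW z0)// mulr_ge0 ?sqrtr_ge0.
have := archi_boundP B0; rewrite ltr_pdivrMr// ltNge => /negP; apply.
apply: le_trans (bound (Num.bound (B / (k * (d ^+ 2 / 4))))).
by rewrite mulrC ler_pM2l// ler_nat.
Qed.

End failure_below_2.

Theorem theorem1p2 (R : realType) :
  (forall alpha : R, 2^-1 < alpha -> maximal_estimate alpha 2) /\
  (forall alpha q : R, 2^-1 < alpha -> 1 <= q -> q < 2 ->
     ~ maximal_estimate alpha q).
Proof.
split; first exact: maximal_estimate_2.
exact: not_maximal_estimate_lt2.
Qed.
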